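(* Let $\boldsymbol K$ and $\tilde{\boldsymbol K}$ be two unital two-term $A_\infty$-modules over the Weyl algebra $A$ satisfying the envelope axioms (E1)--(E3). Then the following are equivalent: (a) $\boldsymbol K$ and $\tilde{\boldsymbol K}$ are strictly isomorphic; (b) $\boldsymbol K$ and $\tilde{\boldsymbol K}$ are isomorphic (as $A_\infty$-modules); (c) $\boldsymbol K$ and $\tilde{\boldsymbol K}$ are quasi-isomorphic; (d) $\boldsymbol K$ and $\tilde{\boldsymbol K}$ determine the same functionals, i.e. $\lambda=\tilde\lambda$ as linear forms $A\to k$, where $\lambda(a):=\bar j\,\big(m_2^1(\bar i,a)\big)$ is the functional attached to $\boldsymbol K$ and $\tilde\lambda$ is the analogous functional attached to $\tilde{\boldsymbol K}$.
   Context: Let $k$ be an algebraically closed field of characteristic zero and $A=A_1(k)=k\langle x,y\rangle/(xy-yx-1)$ the first Weyl algebra, with fixed generators $x,y$. Two-term $A_\infty$-modules. A unital two-term (right) $A_\infty$-module over $A$ is a graded vector space $\boldsymbol K=K^0\oplus K^1$ (degrees $0,1$) with linear maps $m_1:K^0\to K^1$, $m_2^0:K^0\otimes A\to K^0$, $m_2^1:K^1\otimes A\to K^1$, $m_3:K^1\otimes A\otimes A\to K^0$ (all other operations vanish for degree reasons) such that for $u\in K^0$, $v\in K^1$, $a,b,c\in A$: $m_1(m_2^0(u,a))=m_2^1(m_1(u),a)$; $m_2^0(m_2^0(u,a),b)-m_2^0(u,ab)=m_3(m_1(u),a,b)$; $m_2^1(m_2^1(v,a),b)-m_2^1(v,ab)=m_1(m_3(v,a,b))$;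 $-m_3(v,ab,c)+m_3(v,a,bc)+m_3(m_2^1(v,a),b,c)-m_2^0(m_3(v,a,b),c)=0$; and $m_2^0(u,1)=u$, $m_2^1(v,1)=v$, $m_3(v,1,a)=m_3(v,a,1)=0$. The cohomology $H^0(\boldsymbol K)=\ker m_1$, $H^1(\boldsymbol K)=\mathrm{coker}\,m_1$ are $A$-modules via $m_2$. Morphisms. An $A_\infty$-morphism $f:\boldsymbol K\to\boldsymbol L$ consists of linear maps $f_1^0:K^0\to L^0$, $f_1^1:K^1\to L^1$, $f_2:K^1\otimes A\to L^0$ with $m_1(f_1^0(u))=f_1^1(m_1(u))$; $f_1^0(m_2^0(u,a))-m_2^0(f_1^0(u),a)=f_2(m_1(u),a)$; $f_1^1(m_2^1(v,a))-m_2^1(f_1^1(v),a)=m_1(f_2(v,a))$; $m_2^0(f_2(v,a),b)+m_3(f_1^1(v),a,b)=f_2(v,ab)-f_2(m_2^1(v,a),b)+f_1^0(m_3(v,a,b))$. Composition: $(g\circ f)_1=g_1f_1$, $(g\circ f)_2(v,a)=g_1^0(f_2(v,a))+g_2(f_1^1(v),a)$; the identity has $f_1=\mathrm{Id}$, $f_2=0$. $f$ is strict if $f_2=0$; it is an $A_\infty$-quasi-isomorphism if $f_1$ induces isomorphisms on $H^0$ and $H^1$. ''Isomorphic'' means there is an invertible $A_\infty$-morphism, ''strictly isomorphic'' that there is a strict isomorphism, and ''quasi-isomorphic'' that there is an $A_\infty$-quasi-isomorphism between the two modules. Envelope axioms for $\boldsymbol K$: (E1) $\dim_kK^1<\infty$;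 (E2) there is $i\in K^0$ such that $m_2^0(i,-):A\to K^0$ is an isomorphism of vector spaces; (E3) for all $a\in A$, $v\in K^1$: $m_3(v,x,a)=0$, $m_3(v,a,y)=0$, and $m_3(v,y,x)\in k\,i$. Associated data: $\bar i:=m_1(i)\in K^1$, and $\bar j:K^1\to k$ is the linear functional defined by $m_3(v,y,x)=\bar j(v)\,i$ for all $v\in K^1$. *)

(* Defs.v *)
(* Membership in a two-sided ideal or in the image of a linear map is turned
   into a boolean by classical logic (boolp). *)
From HB Require Import structures.
From mathcomp Require Import all_boot all_algebra.
From mathcomp Require Import sesquilinear generic_quotient ring_quotient.
From mathcomp Require Import boolp.
From mathcomp Require Import finmap monalg.

Set Implicit Arguments.
Unset Strict Implicit.
Unset Printing Implicit Defensive.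

Import GRing.Theory.
Local Open Scope ring_scope.
Local Open Scope quotient_scope.

(* The quotient of a left module by a submodule; ring_quotient only equips
   quotients by additive subgroups with a zmodType structure. *)
Definition lmod_quot (R : pzRingType) (V : lmodType R)
  (S : zmodClosed V) (_ : GRing.scaler_closed S) : Type := Quotient.quot S.

Section LmodQuotient.
Context (R : pzRingType) (V : lmodType R) (S : zmodClosed V).
Context (SZ : GRing.scaler_closed S).
Local Notation Q := (lmod_quot SZ).

HB.instance Definition _ : EqQuotient V (Quotient.equiv S) Q :=
  EqQuotient.on (Quotient.quot S).
HB.instance Definition _ := GRing.Zmodule.copy Q (Quotient.quot S).

Lemma lquot_eqP (u v : V) : reflect (\pi_Q u = \pi_Q v) (u - v \in S).
Proof. by rewrite Quotient.idealrBE; apply: eqP. Qed.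

Lemma lquot_surj (c : Q) : exists u, c = \pi_Q u.
Proof. by exists (repr c); rewrite reprK. Qed.

Lemma lquot_piD (u v : V) : \pi_Q (u + v) = \pi_Q u + \pi_Q v.
Proof. exact: Quotient.pi_add. Qed.

Definition lquot_scale (a : R) (c : Q) : Q := \pi_Q (a *: repr c).

Lemma lquot_piZ a (u : V) : \pi_Q (a *: u) = lquot_scale a (\pi_Q u).
Proof.
apply/lquot_eqP; rewrite -scalerBr; apply: SZ.
by apply/lquot_eqP; rewrite reprK.
Qed.

Lemma lquot_scaleA a b c :
  lquot_scale a (lquot_scale b c) = lquot_scale (a * b) c.
Proof. by have [u ->] := lquot_surj c; rewrite -!lquot_piZ scalerA. Qed.

Lemma lquot_scale1 c : lquot_scale 1 c = c.
Proof. by have [u ->] := lquot_surj c; rewrite -!lquot_piZ scale1r. Qed.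

Lemma lquot_scaleDr a c d :
  lquot_scale a (c + d) = lquot_scale a c + lquot_scale a d.
Proof.
have [u ->] := lquot_surj c; have [v ->] := lquot_surj d.
by rewrite -lquot_piD -!lquot_piZ -lquot_piD scalerDr.
Qed.

Lemma lquot_scaleDl c a b :
  lquot_scale (a + b) c = lquot_scale a c + lquot_scale b c.
Proof.
by have [u ->] := lquot_surj c; rewrite -!lquot_piZ -lquot_piD scalerDl.
Qed.

HB.instance Definition _ := GRing.Zmodule_isLmodule.Build R Q
  lquot_scaleA lquot_scale1 lquot_scaleDr lquot_scaleDl.

Lemma lquot_pi_is_linear : linear (\pi_Q : V -> Q).
Proof. by move=> a u v; rewrite lquot_piD lquot_piZ. Qed.

End LmodQuotient.

Section TwoSidedQuotient.
Context (k : fieldType) (F : algType k) (r : F).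

Definition two_sided_ideal : {pred F} := fun f =>
  `[< exists s : seq (F * F), f = \sum_(p <- s) p.1 * r * p.2 >].

Lemma two_sided_idealP f :
  reflect (exists s : seq (F * F), f = \sum_(p <- s) p.1 * r * p.2)
          (f \in two_sided_ideal).
Proof. exact: asboolP. Qed.

Lemma two_sided_ideal_submod_closed : submod_closed two_sided_ideal.
Proof.
split=> [|a f g /two_sided_idealP[s ->] /two_sided_idealP[t ->]].
  by apply/two_sided_idealP; exists [::]; rewrite big_nil.
apply/two_sided_idealP; exists ([seq (a *: p.1, p.2) | p <- s] ++ t).
rewrite big_cat big_map scaler_sumr /=; congr (_ + _).
by apply: eq_bigr => p _; rewrite -!scalerAl.
Qed.

HB.instance Definition _ :=
  GRing.isSubmodClosed.Build k F two_sided_ideal two_sided_ideal_submod_closed.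

Lemma two_sided_idealZ : GRing.scaler_closed two_sided_ideal.
Proof. by move=> a f; apply: rpredZ. Qed.

Lemma two_sided_idealMl f g :
  g \in two_sided_ideal -> f * g \in two_sided_ideal.
Proof.
move=> /two_sided_idealP[s ->]; apply/two_sided_idealP.
exists [seq (f * p.1, p.2) | p <- s]; rewrite big_map mulr_sumr.
by apply: eq_bigr => p _; rewrite !mulrA.
Qed.

Lemma two_sided_idealMr f g :
  f \in two_sided_ideal -> f * g \in two_sided_ideal.
Proof.
move=> /two_sided_idealP[s ->]; apply/two_sided_idealP.
exists [seq (p.1, p.2 * g) | p <- s]; rewrite big_map mulr_suml.
by apply: eq_bigr => p _; rewrite !mulrA.
Qed.

Context (r_proper : 1 \notin two_sided_ideal).

(* F / (r); the properness proof is needed since an algType is nontrivial. *)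
Definition alg_quot of 1 \notin two_sided_ideal : Type :=
  lmod_quot two_sided_idealZ.
Local Notation Q := (alg_quot r_proper).

HB.instance Definition _ := EqQuotient.on Q.
HB.instance Definition _ := GRing.Lmodule.on Q.

Definition aquot_one : Q := \pi_Q 1.
(* Locked, here and below for the generators, only to keep failing unification
   problems in the quotient from unfolding down to the free algebra. *)
Fact aquot_mul_key : unit. Proof. exact: tt. Qed.
Definition aquot_mul : Q -> Q -> Q :=
  locked_with aquot_mul_key (fun a b : Q => \pi_Q (repr a * repr b)).

Lemma aquot_mulE (a b : Q) : aquot_mul a b = \pi_Q (repr a * repr b).
Proof. by rewrite /aquot_mul; case: aquot_mul_key. Qed.

Lemma aquot_eqP (f g : F) :
  reflect (\pi_Q f = \pi_Q g) (f - g \in two_sided_ideal).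
Proof. exact: lquot_eqP. Qed.

Lemma aquot_surj (c : Q) : exists f, c = \pi_Q f.
Proof. exact: lquot_surj. Qed.

Lemma aquot_piD (f g : F) : \pi_Q (f + g) = \pi_Q f + \pi_Q g.
Proof. exact: lquot_piD. Qed.

Lemma aquot_piZ a (f : F) : \pi_Q (a *: f) = a *: \pi_Q f.
Proof. exact: lquot_piZ. Qed.

Lemma aquot_piM f g : \pi_Q (f * g) = aquot_mul (\pi_Q f) (\pi_Q g).
Proof.
rewrite aquot_mulE.
set f' := repr (\pi_Q f); set g' := repr (\pi_Q g).
apply/aquot_eqP.
have -> : f * g - f' * g' = (f - f') * g + f' * (g - g').
  by rewrite mulrBl mulrBr addrA subrK.
apply: rpredD; [apply: two_sided_idealMr | apply: two_sided_idealMl];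
by apply/aquot_eqP; rewrite reprK.
Qed.

Lemma aquot_mulA : associative aquot_mul.
Proof.
move=> a b c; have [f ->] := aquot_surj a.
have [g ->] := aquot_surj b; have [h ->] := aquot_surj c.
by rewrite -!aquot_piM mulrA.
Qed.

Lemma aquot_mul1 : left_id aquot_one aquot_mul.
Proof. by move=> a; have [f ->] := aquot_surj a; rewrite -aquot_piM mul1r. Qed.

Lemma aquot_mulr1 : right_id aquot_one aquot_mul.
Proof. by move=> a; have [f ->] := aquot_surj a; rewrite -aquot_piM mulr1. Qed.

Lemma aquot_mulDl : left_distributive aquot_mul +%R.
Proof.
move=> a b c; have [f ->] := aquot_surj a.
have [g ->] := aquot_surj b; have [h ->] := aquot_surj c.
by rewrite -aquot_piD -!aquot_piM -aquot_piD mulrDl.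
Qed.

Lemma aquot_mulDr : right_distributive aquot_mul +%R.
Proof.
move=> a b c; have [f ->] := aquot_surj a.
have [g ->] := aquot_surj b; have [h ->] := aquot_surj c.
by rewrite -aquot_piD -!aquot_piM -aquot_piD mulrDr.
Qed.

Lemma aquot_one_neq0 : aquot_one != 0.
Proof.
apply: contra r_proper => /eqP pi1; rewrite -[1]subr0; apply/aquot_eqP.
rewrite -[LHS]/aquot_one pi1; apply: (addrI (\pi_Q 0)).
by rewrite -aquot_piD !addr0.
Qed.

HB.instance Definition _ := GRing.Zmodule_isNzRing.Build Q
  aquot_mulA aquot_mul1 aquot_mulr1 aquot_mulDl aquot_mulDr aquot_one_neq0.

Lemma aquot_scaleAl (a : k) (b c : Q) : a *: (b * c) = (a *: b) * c.
Proof.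
have [f ->] := aquot_surj b; have [g ->] := aquot_surj c.
by rewrite -[_ * _]aquot_piM -!aquot_piZ scalerAl aquot_piM.
Qed.

HB.instance Definition _ := GRing.Lmodule_isLalgebra.Build k Q aquot_scaleAl.

Lemma aquot_scaleAr (a : k) (b c : Q) : a *: (b * c) = b * (a *: c).
Proof.
have [f ->] := aquot_surj b; have [g ->] := aquot_surj c.
by rewrite -[_ * _]aquot_piM -!aquot_piZ scalerAr aquot_piM.
Qed.

HB.instance Definition _ := GRing.Lalgebra_isAlgebra.Build k Q aquot_scaleAr.

Definition aquot_pi (f : F) : Q := \pi_Q f.

Lemma aquot_pi_is_linear : linear aquot_pi.
Proof. by move=> a f g; rewrite /aquot_pi aquot_piD aquot_piZ. Qed.

Lemma aquot_pi_is_monoid_morphism : monoid_morphism aquot_pi.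
Proof. by split=> // f g; apply: aquot_piM. Qed.

HB.instance Definition _ :=
  GRing.isLinear.Build k F Q *:%R aquot_pi aquot_pi_is_linear.
HB.instance Definition _ :=
  GRing.isMonoidMorphism.Build F Q aquot_pi aquot_pi_is_monoid_morphism.

Lemma aquot_pi_rel : aquot_pi r = 0.
Proof.
rewrite -(linear0 aquot_pi); apply/aquot_eqP; rewrite subr0.
by apply/two_sided_idealP; exists [:: (1, 1)]; rewrite big_seq1 mul1r mulr1.
Qed.

End TwoSidedQuotient.

Lemma aquot_pi_commutator (k : fieldType) (F : algType k) (x y : F)
  (P : 1 \notin two_sided_ideal (x * y - y * x - 1)) :
  aquot_pi P x * aquot_pi P y - aquot_pi P y * aquot_pi P x = 1.
Proof.
apply/eqP; rewrite -subr_eq0; apply/eqP.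
by rewrite -[RHS](aquot_pi_rel P) !rmorphB !rmorphM rmorph1.
Qed.

Section WeylAlgebra.
Context (k : fieldType).

(* k<x,y> (false for x, true for y): the monoid algebra of the
   free monoid on bool. *)
Definition free2 : Type := {malg k[{fmonom bool}]}.
HB.instance Definition _ := GRing.Lalgebra.on free2.

Lemma free_mulUU (a b : k) (u v : {fmonom bool}) :
  (<< a *g u >> : free2) * (<< b *g v >> : free2)
  = << a * b *g mmul u v >> :> free2.
Proof. exact: fgmulUU. Qed.

Lemma free_scaleU (a b : k) (u : {fmonom bool}) :
  a *: (<< b *g u >> : free2) = << a * b *g u >> :> free2.
Proof.
apply/malgP => v; apply: (etrans (mcoeffZ _ _ _)).
by apply: (etrans (congr1 _ (mcoeffU _ _ _))); rewrite mcoeffU mulrnAr.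
Qed.

Lemma free_sumU (f : free2) :
  f = \sum_(w <- msupp f) (<< f@_w *g w >> : free2).
Proof. exact: monalgE. Qed.

Lemma free_mulE (f g : free2) :
  f * g = \sum_(u <- msupp f) \sum_(v <- msupp g)
            (<< f@_u * g@_v *g mmul u v >> : free2).
Proof. exact: malgM_def. Qed.

Lemma free_scaleAr a (f g : free2) : a *: (f * g) = f * (a *: g).
Proof.
rewrite [f]free_sumU mulr_suml scaler_sumr mulr_suml.
apply: eq_bigr => u _.
have : forall c v, a *: ((<< f@_u *g u >> : free2) * (<< c *g v >> : free2))
                 = (<< f@_u *g u >> : free2) * (a *: (<< c *g v >> : free2)).
  move=> c v; apply: (etrans (congr1 _ (free_mulUU _ _ _ _))).
  apply: (etrans (free_scaleU _ _ _)); apply: esym.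
  apply: (etrans (congr1 _ (free_scaleU _ _ _))).
  by apply: (etrans (free_mulUU _ _ _ _)); rewrite mulrCA.
move: (<< _ *g u >> : free2) => e He.
rewrite [g]free_sumU [in LHS]mulr_sumr [in LHS]scaler_sumr.
rewrite [in RHS]scaler_sumr [in RHS]mulr_sumr.
by apply: eq_bigr => v _; apply: He.
Qed.

HB.instance Definition _ := GRing.Lalgebra_isAlgebra.Build k free2 free_scaleAr.

Definition free_x : free2 := << fmu false >>.
Definition free_y : free2 := << fmu true >>.
Definition weyl_rel : free2 := free_x * free_y - free_y * free_x - 1.

(* The action on k[X] (x by d/dX, y by multiplication by X), used to see that
   the ideal is proper. *)
Definition gen_act (b : bool) (p : {poly k}) : {poly k} :=
  if b then 'X * p else p^`().

Definition word_act (w : {fmonom bool}) (p : {poly k}) : {poly k} :=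
  foldr gen_act p w.

Arguments word_act : simpl never.

Definition free_act (f : free2) (p : {poly k}) : {poly k} :=
  \sum_(w <- msupp f) f@_w *: word_act w p.

Lemma free_actEw (f : free2) (d : {fset {fmonom bool}}) p :
  (msupp f `<=` d)%fset -> free_act f p = \sum_(w <- d) f@_w *: word_act w p.
Proof.
move=> le_fd; rewrite /free_act (big_fset_incl _ le_fd) // => w _.
by move=> /mcoeff_outdom ->; rewrite scale0r.
Qed.

Lemma free_actU c w p : free_act << c *g w >> p = c *: word_act w p.
Proof. by rewrite (free_actEw _ msuppU_le) big_seq_fset1 mcoeffUU. Qed.

Lemma free_actD f g p : free_act (f + g) p = free_act f p + free_act g p.
Proof.
rewrite (free_actEw p (msuppD_le f g)).
rewrite (free_actEw p (fsubsetUl (msupp f) (msupp g))).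
rewrite (free_actEw p (fsubsetUr (msupp f) (msupp g))) -big_split /=.
by apply: eq_bigr => w _; rewrite mcoeffD scalerDl.
Qed.

Lemma free_act0 p : free_act 0 p = 0.
Proof. by rewrite /free_act msupp0 big_seq_fset0. Qed.

Lemma free_actN f p : free_act (- f) p = - free_act f p.
Proof.
by apply: (addrI (free_act f p)); rewrite -free_actD !subrr free_act0.
Qed.

Lemma free_act_sum (I : Type) (s : seq I) (F : I -> free2) p :
  free_act (\sum_(i <- s) F i) p = \sum_(i <- s) free_act (F i) p.
Proof.
elim: s => [|i s IH]; first by rewrite !big_nil free_act0.
by rewrite !big_cons free_actD IH.
Qed.

Lemma gen_act_is_linear b : linear (gen_act b).
Proof.
move=> a p q; rewrite /gen_act; case: b.
  by rewrite mulrDr scalerAr.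
by rewrite derivD derivZ.
Qed.

Lemma word_act_is_linear w : linear (word_act w).
Proof.
move=> a p q; rewrite /word_act.
by elim: (w : seq bool) => //= b s ->; rewrite gen_act_is_linear.
Qed.

HB.instance Definition _ w :=
  GRing.isLinear.Build k {poly k} {poly k} *:%R (word_act w)
    (word_act_is_linear w).

Lemma free_act_is_linear f : linear (free_act f).
Proof.
move=> a p q; rewrite /free_act scaler_sumr -big_split /=.
by apply: eq_bigr => w _; rewrite linearP scalerDr !scalerA mulrC.
Qed.

HB.instance Definition _ f :=
  GRing.isLinear.Build k {poly k} {poly k} *:%R (free_act f)
    (free_act_is_linear f).

Lemma free_actM f g p : free_act (f * g) p = free_act f (free_act g p).
Proof.
rewrite free_mulE free_act_sum [RHS]/free_act.
apply: eq_bigr => u _; rewrite free_act_sum {2}/free_act linear_sum scaler_sumr.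
apply: eq_bigr => v _; rewrite free_actU linearZ /= scalerA.
by congr (_ *: _); rewrite /word_act fmM foldr_cat.
Qed.

Lemma free_act1 p : free_act 1 p = p.
Proof. by rewrite [LHS]free_actU scale1r /word_act fm1. Qed.

Lemma free_act_commutator f g p :
  free_act (f * g - g * f - 1) p
  = free_act f (free_act g p) - free_act g (free_act f p) - p.
Proof.
apply: (etrans (free_actD _ _ _)); rewrite free_actN free_act1.
congr (_ - _); apply: (etrans (free_actD _ _ _)); rewrite free_actN.
by congr (_ - _); apply: free_actM.
Qed.

Lemma free_act_rel p : free_act weyl_rel p = 0.
Proof.
have genE b q : free_act << fmu b >> q = gen_act b q.
  by rewrite free_actU scale1r /word_act fmU.
apply: (etrans (free_act_commutator _ _ _)).
have -> : free_act free_x (free_act free_y p) = gen_act false (gen_act true p).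
  exact: etrans (genE _ _) (congr1 _ (genE _ _)).
have -> : free_act free_y (free_act free_x p) = gen_act true (gen_act false p).
  exact: etrans (genE _ _) (congr1 _ (genE _ _)).
by rewrite /gen_act derivM derivX mul1r addrK subrr.
Qed.

Lemma weyl_rel_proper : 1 \notin two_sided_ideal weyl_rel.
Proof.
apply/negP => /two_sided_idealP[s /(congr1 (free_act^~ 1))] /=.
rewrite free_act1 free_act_sum big1 => [/eqP|i _]; first by rewrite oner_eq0.
by rewrite (free_actM (i.1 * _)) free_actM free_act_rel linear0.
Qed.

Definition weyl : Type := alg_quot weyl_rel_proper.
HB.instance Definition _ := GRing.Algebra.on weyl.

End WeylAlgebra.

HB.lock Definition weyl_x (k : fieldType) : weyl k :=
  aquot_pi (weyl_rel_proper k) (free_x k).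
HB.lock Definition weyl_y (k : fieldType) : weyl k :=
  aquot_pi (weyl_rel_proper k) (free_y k).

Lemma weyl_relation (k : fieldType) :
  weyl_x k * weyl_y k - weyl_y k * weyl_x k = 1.
Proof. by rewrite weyl_x.unlock weyl_y.unlock; apply: aquot_pi_commutator. Qed.

(* A unital two-term A-infinity module.  deg0 and deg1 are K^0 and K^1, m20 and
   m21 are the components of m_2 on K^0 and K^1, and a map out of a triple
   tensor product is encoded as a curried function linear in each argument. *)
Record ainf_module (k : fieldType) (A : algType k) := AinfModule {
  deg0 : lmodType k;
  deg1 : lmodType k;
  m1 : {linear deg0 -> deg1};
  m20 : {bilinear deg0 -> A -> deg0};
  m21 : {bilinear deg1 -> A -> deg1};
  m3 : deg1 -> A -> A -> deg0;
  m3_linear1 : forall a b, linear (fun v => m3 v a b);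
  m3_linear2 : forall v b, linear (fun a => m3 v a b);
  m3_linear3 : forall v a, linear (fun b => m3 v a b);
  m1_m2 : forall u a, m1 (m20 u a) = m21 (m1 u) a;
  m20_assoc : forall u a b, m20 (m20 u a) b - m20 u (a * b) = m3 (m1 u) a b;
  m21_assoc : forall v a b, m21 (m21 v a) b - m21 v (a * b) = m1 (m3 v a b);
  m3_coherence : forall v a b c,
    - m3 v (a * b) c + m3 v a (b * c) + m3 (m21 v a) b c
      - m20 (m3 v a b) c = 0;
  m20_unit : forall u, m20 u 1 = u;
  m21_unit : forall v, m21 v 1 = v;
  m3_unitl : forall v a, m3 v 1 a = 0;
  m3_unitr : forall v a, m3 v a 1 = 0
}.
Arguments m3 [k A] K v a b : rename.

Section Cohomology.
Context (k : fieldType) (A : algType k) (K : ainf_module A).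

Definition cocycle0 : {pred deg0 K} := fun u => m1 K u == 0.

Lemma cocycle0_submod_closed : submod_closed cocycle0.
Proof.
split=> [|a u v]; rewrite !unfold_in /cocycle0 ?linear0 // => /eqP u0 /eqP v0.
by rewrite linearP u0 v0 scaler0 addr0.
Qed.

HB.instance Definition _ :=
  GRing.isSubmodClosed.Build k (deg0 K) cocycle0 cocycle0_submod_closed.

Definition H0 : Type := {u : deg0 K | u \in cocycle0}.
HB.instance Definition _ := SubChoice.on H0.
HB.instance Definition _ := [SubChoice_isSubLmodule of H0 by <:].

Definition coboundary1 : {pred deg1 K} := fun v => `[< exists u, v = m1 K u >].

Lemma coboundary1P v : reflect (exists u, v = m1 K u) (v \in coboundary1).
Proof. exact: asboolP. Qed.

Lemma coboundary1_submod_closed : submod_closed coboundary1.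
Proof.
split=> [|a v w /coboundary1P[u ->] /coboundary1P[u' ->]].
  by apply/coboundary1P; exists 0; rewrite linear0.
by apply/coboundary1P; exists (a *: u + u'); rewrite linearP.
Qed.

HB.instance Definition _ :=
  GRing.isSubmodClosed.Build k (deg1 K) coboundary1 coboundary1_submod_closed.

Lemma coboundary1Z : GRing.scaler_closed coboundary1.
Proof. by move=> a v; apply: rpredZ. Qed.

Definition H1 : Type := lmod_quot coboundary1Z.
HB.instance Definition _ := EqQuotient.on H1.
HB.instance Definition _ := GRing.Lmodule.on H1.

End Cohomology.
Arguments cocycle0 [k A] K u : rename.
Arguments coboundary1 [k A] K v : rename.

Record ainf_mor (k : fieldType) (A : algType k) (K L : ainf_module A) :=
AinfMor {
  f10 : {linear deg0 K -> deg0 L};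
  f11 : {linear deg1 K -> deg1 L};
  f2 : {bilinear deg1 K -> A -> deg0 L};
  f1_m1 : forall u, m1 L (f10 u) = f11 (m1 K u);
  f10_m20 : forall u a, f10 (m20 K u a) - m20 L (f10 u) a = f2 (m1 K u) a;
  f11_m21 : forall v a, f11 (m21 K v a) - m21 L (f11 v) a = m1 L (f2 v a);
  f2_m2 : forall v a b,
    m20 L (f2 v a) b + m3 L (f11 v) a b
    = f2 v (a * b) - f2 (m21 K v a) b + f10 (m3 K v a b)
}.

Section Morphisms.
Context (k : fieldType) (A : algType k).
Implicit Types K L M : ainf_module A.

Definition ainf_mor_eq K L (f g : ainf_mor K L) : Prop :=
  [/\ f10 f =1 f10 g, f11 f =1 f11 g & f2 f =2 f2 g].

Section Identity.
Context K.

Definition id_f2 (v : deg1 K) (a : A) : deg0 K := 0.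

Lemma id_f2_bilinear : bilinear_for *:%R *:%R id_f2.
Proof. by split=> [a c u v|v c a b]; rewrite /id_f2 /= scaler0 addr0. Qed.

HB.instance Definition _ :=
  bilinear_isBilinear.Build k (deg1 K) A (deg0 K) *:%R *:%R id_f2
    id_f2_bilinear.

Lemma id_f10_m20 (u : deg0 K) a : m20 K u a - m20 K u a = id_f2 (m1 K u) a.
Proof. exact: subrr. Qed.

Lemma id_f11_m21 (v : deg1 K) a :
  m21 K v a - m21 K v a = m1 K (id_f2 v a).
Proof. by rewrite subrr linear0. Qed.

Lemma id_f2_m2 (v : deg1 K) a b :
  m20 K (id_f2 v a) b + m3 K v a b
  = id_f2 v (a * b) - id_f2 (m21 K v a) b + m3 K v a b.
Proof. by rewrite /id_f2 linear0l subrr. Qed.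

Definition ainf_id : ainf_mor K K :=
  @AinfMor k A K K idfun idfun id_f2 (fun=> erefl) id_f10_m20 id_f11_m21
    id_f2_m2.

End Identity.

Section Composition.
Context K L M (g : ainf_mor L M) (f : ainf_mor K L).

Definition comp_f2 (v : deg1 K) (a : A) : deg0 M :=
  f10 g (f2 f v a) + f2 g (f11 f v) a.

Lemma comp_f2_bilinear : bilinear_for *:%R *:%R comp_f2.
Proof.
split=> [a c u v|v c a b]; rewrite /comp_f2.
  by rewrite linearP linearPl linearPl linearP /= scalerDr addrACA.
by rewrite linearPr linearPr linearP /= scalerDr addrACA.
Qed.

HB.instance Definition _ :=
  bilinear_isBilinear.Build k (deg1 K) A (deg0 M) *:%R *:%R comp_f2
    comp_f2_bilinear.

Lemma comp_f1_m1 (u : deg0 K) :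
  m1 M (f10 g (f10 f u)) = f11 g (f11 f (m1 K u)).
Proof. by rewrite !f1_m1. Qed.

Lemma comp_f10_m20 (u : deg0 K) a :
  f10 g (f10 f (m20 K u a)) - m20 M (f10 g (f10 f u)) a
  = comp_f2 (m1 K u) a.
Proof.
by rewrite /comp_f2 -f10_m20 linearB /= -f1_m1 -f10_m20 addrA subrK.
Qed.

Lemma comp_f11_m21 (v : deg1 K) a :
  f11 g (f11 f (m21 K v a)) - m21 M (f11 g (f11 f v)) a
  = m1 M (comp_f2 v a).
Proof.
rewrite /comp_f2 linearD /= f1_m1 -f11_m21 linearB /= -f11_m21.
by rewrite addrA subrK.
Qed.

Lemma comp_f2_m2 (v : deg1 K) a b :
  m20 M (comp_f2 v a) b + m3 M (f11 g (f11 f v)) a b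
  = comp_f2 v (a * b) - comp_f2 (m21 K v a) b + f10 g (f10 f (m3 K v a b)).
Proof.
rewrite /comp_f2 linearDl -addrA f2_m2 opprD [in RHS]addrACA [RHS]addrAC.
have := congr1 (f10 g) (f2_m2 f v a b).
rewrite linearD [RHS]linearD linearB /= => <-.
have -> : m20 M (f10 g (f2 f v a)) b
    = f10 g (m20 L (f2 f v a) b)
      + (f2 g (m21 L (f11 f v) a) b - f2 g (f11 f (m21 K v a)) b).
  rewrite -opprB -linearBl f11_m21 -f10_m20.
  by rewrite opprB addrC subrK.
rewrite [X in _ + X = _]addrC addrACA; congr (_ + _).
by rewrite addrC addrA subrK.
Qed.

Definition ainf_comp : ainf_mor K M :=
  @AinfMor k A K M (f10 g \o f10 f) (f11 g \o f11 f) comp_f2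
    comp_f1_m1 comp_f10_m20 comp_f11_m21 comp_f2_m2.

End Composition.

Section Induced.
Context K L (f : ainf_mor K L).

Lemma f10_cocycle (c : H0 K) : f10 f (val c) \in cocycle0 L.
Proof. by apply/eqP; rewrite f1_m1 (eqP (valP c)) linear0. Qed.

Definition H0_map (c : H0 K) : H0 L := Sub (f10 f (val c)) (f10_cocycle c).

Definition H1_map (c : H1 K) : H1 L := \pi_(H1 L) (f11 f (repr c)).

Lemma H1_mapE v : H1_map (\pi_(H1 K) v) = \pi_(H1 L) (f11 f v).
Proof.
apply/lquot_eqP; rewrite -linearB.
have /(introT (lquot_eqP (coboundary1Z (K := K)) _ _))/coboundary1P[u ->] :
  \pi_(H1 K) (repr (\pi_(H1 K) v)) = \pi_(H1 K) v by rewrite reprK.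
by apply/coboundary1P; exists (f10 f u); rewrite f1_m1.
Qed.

(* The induced maps are automatically linear (and A-linear: f_1 commutes with
   m_2 up to terms vanishing in cohomology), so they are isomorphisms exactly
   when they are bijective. *)
Lemma H0_map_is_linear : linear H0_map.
Proof. by move=> a c d; apply: val_inj; rewrite /= linearP. Qed.

Lemma H1_map_is_linear : linear H1_map.
Proof.
move=> a c d; rewrite -[c]reprK -[d]reprK.
move: (repr c) (repr d) => v w.
have piP M b (v' w' : deg1 M) :
    \pi_(H1 M) (b *: v' + w') = b *: \pi_(H1 M) v' + \pi_(H1 M) w'.
  exact: lquot_pi_is_linear.
by rewrite -piP !H1_mapE -piP linearP.
Qed.

HB.instance Definition _ :=
  GRing.isLinear.Build k (H0 K) (H0 L) *:%R H0_map H0_map_is_linear.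
HB.instance Definition _ :=
  GRing.isLinear.Build k (H1 K) (H1 L) *:%R H1_map H1_map_is_linear.

Definition strict : Prop := forall v a, f2 f v a = 0.

Definition ainf_invertible : Prop :=
  exists g : ainf_mor L K,
    ainf_mor_eq (ainf_comp g f) (ainf_id K) /\
    ainf_mor_eq (ainf_comp f g) (ainf_id L).

Definition quasi_iso : Prop := bijective H0_map /\ bijective H1_map.

End Induced.

Definition strictly_isomorphic K L : Prop :=
  exists f : ainf_mor K L, strict f /\ ainf_invertible f.

Definition isomorphic K L : Prop :=
  exists f : ainf_mor K L, ainf_invertible f.

Definition quasi_isomorphic K L : Prop :=
  exists f : ainf_mor K L, quasi_iso f.

End Morphisms.

Definition finite_dim (k : fieldType) (V : lmodType k) : Prop :=
  exists (n : nat) (phi : {linear V -> 'rV[k]_n}), bijective phi.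

(* The generator i is data; m_3(v, y, x) is only required to lie on its line. *)
Record envelope (k : fieldType) (K : ainf_module (weyl k)) := Envelope {
  env_i : deg0 K;
  env_finite : finite_dim (deg1 K);
  env_bij : bijective (m20 K env_i);
  env_m3x : forall v a, m3 K v (weyl_x k) a = 0;
  env_m3y : forall v a, m3 K v a (weyl_y k) = 0;
  env_m3yx : forall v, exists c : k,
    m3 K v (weyl_y k) (weyl_x k) == c *: env_i
}.

Section EnvelopeData.
Context (k : fieldType) (K : ainf_module (weyl k)) (E : envelope K).

Definition ibar : deg1 K := m1 K (env_i E).

Definition jbar (v : deg1 K) : k := xchoose (env_m3yx E v).

Lemma jbarP v : m3 K v (weyl_y k) (weyl_x k) = jbar v *: env_i E.
Proof. exact/eqP/(xchooseP (env_m3yx E v)). Qed.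

Lemma env_i_neq0 : env_i E != 0.
Proof.
apply/eqP => i0; have /bij_inj inj := env_bij E.
have /eqP := oner_neq0 (weyl k); apply; apply: inj.
by rewrite i0 !linear0l.
Qed.

Lemma jbar_unique v c :
  m3 K v (weyl_y k) (weyl_x k) = c *: env_i E -> jbar v = c.
Proof.
rewrite jbarP => /eqP; rewrite -subr_eq0 -scalerBl scaler_eq0.
by rewrite (negPf env_i_neq0) orbF subr_eq0 => /eqP.
Qed.

Lemma jbar_is_linear : linear (jbar : deg1 K -> k^o).
Proof.
move=> a u v; apply: jbar_unique.
by rewrite m3_linear1 !jbarP scalerDl scalerA.
Qed.

Definition lambda (a : weyl k) : k := jbar (m21 K ibar a).

Lemma lambda_is_linear : linear (lambda : weyl k -> k^o).
Proof. by move=> c a b; rewrite /lambda linearPr jbar_is_linear. Qed.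

End EnvelopeData.

(* Main.v *)
From HB Require Import structures.
Require Import Defs.
From mathcomp Require Import ssrAC all_boot all_algebra.
From mathcomp Require Import sesquilinear generic_quotient boolp ring.
From mathcomp Require Import finmap monalg.

Set Implicit Arguments.
Unset Strict Implicit.
Unset Printing Implicit Defensive.

Import GRing.Theory.
Local Open Scope ring_scope.

(** Let X and Y be the right actions of x and y on K^1, and write i and ib for the
    generator of K^0 and its image under m_1.  As m_3(v, a, b) vanishes for a = x
    and for b = y, normally ordered monomials act by v.(x^p y^q) = v X^p Y^q, and
    the defect of associativity is concentrated in the Calogero-Moser equation
    v.x.y - v.y.x = v - j(v) ib.  The whole envelope can be recovered from X, Y, ib
    and j, and in characteristic zero these are rigid because the Weyl algebra has
    no nonzero finite-dimensional module (weyl_subquotient_trivial).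

    From equal functionals to a strict isomorphism.  The candidate is
    i.a |-> i'.a in degree 0.  It commutes with y by normal ordering, and with x
    because the correction is j(m_1(i.a)), that is, the functional itself.  On
    K^1 / im m_1 and on the image of ker m_1 in K'^1 the rank one term of the
    Calogero-Moser equation vanishes, leaving finite-dimensional modules over the
    Weyl algebra; hence m_1 is onto and the candidate maps ker m_1 into ker m'_1,
    so that it descends to K^1.  Finally m_3 is computed from the actions and j by
    the coherence relation, so it is respected (strict_morphism_of_lambda).

    From a quasi-isomorphism to equal functionals.  The normally ordered
    monomials form a basis of the Weyl algebra, so that K^0 becomes the space
    k[x,y] of bivariate polynomials, on which y acts by multiplication and x by
    multiplication up to terms of smaller y-degree (env_datum).  A morphism f
    gives a linear endomorphism F of k[x,y], and a homotopy makes f_2(v, y) a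
    polynomial in x alone (cm_normalize).  Then F(b) is c b, with c = F(1), up to
    terms of smaller degree, first for the degree in y and, once c does not
    involve y, for the degree in x.  If c had positive degree in y, the image of
    F would contain no nonzero polynomial in x alone; but K'^1 being
    finite-dimensional, some such polynomial lies in ker m'_1, which is the image
    of ker m_1 by surjectivity on H^0.  The same argument with x and y exchanged
    shows that c is a scalar, nonzero because F is.  Evaluating f_2 on the relation
    y x = x y - 1 then gives f_2(v, x) = f_2(v, y) = 0 and j'(f(v)) = c j(v), and
    the functionals agree (cm_mor_rigid). *)

(** * Induction along normally ordered words in the Weyl algebra *)

Section WeylInduction.
Context (k : fieldType).
Local Notation A := (weyl k).
Local Notation x := (weyl_x k).
Local Notation y := (weyl_y k).

Lemma weyl_yx : y * x = x * y - 1.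
Proof. by rewrite -(weyl_relation k) subKr. Qed.

Lemma weyl_left_ind (S : A -> Prop) :
  (forall c a b, S a -> S b -> S (c *: a + b)) -> S 1 ->
  (forall a, S a -> S (x * a)) -> (forall a, S a -> S (y * a)) ->
  forall a, S a.
Proof.
move=> Slin S1 Sx Sy a.
have S0 : S 0 by have := Slin (-1) 1 1 S1 S1; rewrite scaleN1r addNr.
have [f ->] := @aquot_surj _ _ _ (weyl_rel_proper k) a; rewrite [f]free_sumU.
have Sword (w : {fmonom bool}) :
    S (aquot_pi (weyl_rel_proper k) (<< w >> : free2 k)).
  case: w => w; elim: w => [|b w IHw].
    have -> : << FMonom [::] >> = 1 :> free2 k; last by rewrite rmorph1.
    by congr (<< _ >>); apply: val_inj; rewrite /= fm1.
  rewrite (_ : (<< _ >> : free2 k) =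
    (<< fmu b >> : free2 k) * (<< FMonom w >> : free2 k)); last first.
    rewrite free_mulUU mulr1; congr (<< _ >>).
    by apply: val_inj; rewrite /= fmM fmU.
  rewrite rmorphM; case: b.
    by have := Sy _ IHw; rewrite weyl_y.unlock.
  by have := Sx _ IHw; rewrite weyl_x.unlock.
elim: (enum_fset (msupp f)) => [|w s IHs].
  by rewrite big_nil; have := S0; rewrite -(raddf0 (aquot_pi (weyl_rel_proper k))).
rewrite big_cons aquot_piD.
rewrite (_ : << f@_w *g w >> = f@_w *: (<< w >> : free2 k)); last first.
  by rewrite free_scaleU mulr1.
rewrite aquot_piZ; apply: Slin; [exact: Sword | exact: IHs].
Qed.

(** The subspace spanned by the monomials x^p y^q is the smallest one that contains
    1 and is stable under x on the left and y on the right; the relation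
    y x = x y - 1 makes it stable under y on the left as well. *)
Lemma weyl_normal_ind (S : A -> Prop) :
  (forall c a b, S a -> S b -> S (c *: a + b)) -> S 1 ->
  (forall a, S a -> S (x * a)) -> (forall a, S a -> S (a * y)) ->
  forall a, S a.
Proof.
move=> Slin S1 Sx Sy a.
pose closed (T : A -> Prop) := [/\ forall c a b, T a -> T b -> T (c *: a + b),
  T 1, forall a, T a -> T (x * a) & forall a, T a -> T (a * y)].
(* N is the smallest subspace with the three closure properties. *)
pose N b := forall T, closed T -> T b.
suff : N a by apply; split.
have Ncl : closed N.
  split=> [c b d Nb Nd T Tcl|T [] //|b Nb T Tcl|b Nb T Tcl].
  - by case: (Tcl) => Tl _ _ _; apply: Tl; [apply: Nb|apply: Nd].
  - by case: (Tcl) => _ _ Tx _; apply: Tx; apply: Nb.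
  - by case: (Tcl) => _ _ _ Ty; apply: Ty; apply: Nb.
case: (Ncl) => Nlin N1 Nx Ny.
elim/weyl_left_ind: a => // a Na; suff [] : N a /\ N (y * a) by [].
apply: (Na (fun a => N a /\ N (y * a))); split=> [c b d [? ?] [? ?]| |b [? ?]|b [? ?]].
- by split; [apply: Nlin|rewrite mulrDr -scalerAr; apply: Nlin].
- by split=> //; rewrite mulr1 -[y]mul1r; apply: Ny.
- split; first exact: Nx.
  rewrite mulrA weyl_yx mulrBl mul1r -mulrA addrC -scaleN1r.
  by apply: Nlin => //; apply: Nx.
- by split; [apply: Ny|rewrite mulrA; apply: Ny].
Qed.

End WeylInduction.

(** * Finite-dimensional modules over the Weyl algebra *)

Section PolynomialsInEndomorphism.
Context (k : fieldType) (V : lmodType k) (X : {linear V -> V}).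

Lemma iter_is_linear i : linear (iter i X).
Proof. by elim: i => // i IHi c u v; rewrite !iterS IHi linearP. Qed.

Definition poly_act (p : {poly k}) (v : V) : V :=
  \sum_(i < size p) p`_i *: iter i X v.

Implicit Types p q : {poly k}.

Lemma poly_act_widen n p v : (size p <= n)%N ->
  poly_act p v = \sum_(i < n) p`_i *: iter i X v.
Proof.
move=> le_pn; rewrite /poly_act.
rewrite (big_ord_widen n (fun i => p`_i *: iter i X v)) // big_mkcond /=.
apply: eq_bigr => i _; case: ltnP => // le_pi.
by rewrite nth_default // scale0r.
Qed.

Lemma poly_act_linear p : linear (poly_act p).
Proof.
move=> c u v; rewrite /poly_act scaler_sumr -big_split /=.
apply: eq_bigr => i _.
by rewrite iter_is_linear scalerDr !scalerA mulrC.
Qed.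

Lemma poly_act_linearl c p q v :
  poly_act (c *: p + q) v = c *: poly_act p v + poly_act q v.
Proof.
pose n := maxn (size p) (size q).
have le_n : (size (c *: p + q)%R <= n)%N.
  apply: leq_trans (size_polyD _ _) _.
  by rewrite geq_max leq_maxr andbT (leq_trans (size_scale_leq _ _)) ?leq_maxl.
rewrite (poly_act_widen _ le_n) (@poly_act_widen n p) ?leq_maxl //.
rewrite (@poly_act_widen n q) ?leq_maxr // scaler_sumr -big_split /=.
by apply: eq_bigr => i _; rewrite coefD coefZ scalerDl scalerA.
Qed.

Lemma poly_actC c v : poly_act c%:P v = c *: v.
Proof.
rewrite (@poly_act_widen 1) ?size_polyC ?leq_b1 //.
by rewrite big_ord1 coefC.
Qed.

Lemma poly_actMX p v : poly_act (p * 'X) v = poly_act p (X v).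
Proof.
rewrite (@poly_act_widen (size p).+1); last first.
  by have [->|/size_mulX ->] := eqVneq p 0; rewrite ?mul0r ?size_poly0.
rewrite big_ord_recl coefMX eqxx scale0r add0r.
by apply: eq_bigr => i _; rewrite coefMX -iterSr.
Qed.

Lemma poly_act_closed (N : V -> Prop) p v :
  (forall c u v, N u -> N v -> N (c *: u + v)) ->
  (forall v, N v -> N (X v)) -> N v -> N (poly_act p v).
Proof.
move=> Nlin NX Nv; have N0 : N 0.
  by have := Nlin (-1) v v Nv Nv; rewrite scaleN1r addNr.
rewrite /poly_act; elim/big_ind: _ => // [u w Nu Nw|i _].
  by have := Nlin 1 u w Nu Nw; rewrite scale1r.
rewrite -[_ *: _]addr0; apply: Nlin => //.
by elim: (i : nat) => //= j; apply: NX.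
Qed.

Lemma poly_act_comm p v : poly_act p (X v) = X (poly_act p v).
Proof.
rewrite /poly_act linear_sum; apply: eq_bigr => i _.
by rewrite linearZ /= -iterSr iterS.
Qed.

End PolynomialsInEndomorphism.

Lemma deriv_eq0_const (R : idomainType) (p : {poly R}) :
  [pchar R] =i pred0 -> p^`() = 0 -> exists c, p = c%:P.
Proof.
move=> char0 dp0; exists p`_0; apply: size1_polyC.
apply/leq_sizeP => -[|i] // _.
have := congr1 (fun q : {poly R} => q`_i) dp0; rewrite coef_deriv coef0 => /eqP.
by rewrite -mulr_natr mulf_eq0 ((pcharf0P R).1 char0) orbF => /eqP.
Qed.

Section WeylSubquotient.
Context (k : fieldType) (char0 : [pchar k] =i pred0).
Context (V : lmodType k) (X Y : {linear V -> V}) (N N0 : V -> Prop).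
Context (N0lin : forall c u v, N0 u -> N0 v -> N0 (c *: u + v)).
Context (NX : forall v, N v -> N (X v)) (NY : forall v, N v -> N (Y v)).
Context (N0X : forall v, N0 v -> N0 (X v)) (N0Y : forall v, N0 v -> N0 (Y v)).
Context (commN : forall v, N v -> N0 (Y (X v) - X (Y v) - v)).

(** If p(X) maps N into N0, then so does p'(X), the commutator of p(X) and Y
    modulo N0; a polynomial of minimal degree with this property is therefore a
    nonzero constant.  Stating this for a pair N, N0 covers both the quotients
    and the subspaces of V on which X and Y satisfy the Weyl relation. *)
Lemma weyl_subquotient_trivial :
  (exists2 p, p != 0 & forall v, poly_act X p v = 0) ->
  forall v, N v -> N0 v.
Proof.
case=> p0 p0n0 p0X v Nv.
have N00 : N0 0.
  have := N0lin (-1) (commN Nv) (commN Nv).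
  by rewrite scaleN1r addNr.
have N0D u w : N0 u -> N0 w -> N0 (u + w).
  by move=> Nu Nw; have := N0lin 1 Nu Nw; rewrite scale1r.
have N0Z c u : N0 u -> N0 (c *: u).
  by move=> Nu; have := N0lin c Nu N00; rewrite addr0.
(* Modulo N0, the commutator of p(X) with Y is p'(X). *)
have comm p : forall w, N w ->
    N0 (Y (poly_act X p w) - poly_act X p (Y w) - poly_act X p^`() w).
  elim/poly_ind: p => [|p c IHp] w Nw.
    rewrite deriv0 /poly_act size_poly0 !big_ord0 linear0 !subr0; exact: N00.
  have Dlin (q r : {poly k}) u :
      poly_act X (q + r) u = poly_act X q u + poly_act X r u.
    by rewrite -[q]scale1r poly_act_linearl !scale1r.
  have BA q u u' : poly_act X q (u - u') = poly_act X q u - poly_act X q u'.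
    rewrite -[u - u']addrC -scaleN1r poly_act_linear scaleN1r.
    by rewrite addrC.
  rewrite derivD derivM derivX derivC mulr1 addr0 !Dlin !poly_actC !poly_actMX.
  rewrite linearD linearZ /=.
  have := IHp _ (NX Nw).
  have := poly_act_closed p N0lin N0X (commN Nw).
  rewrite !BA => N1 N2; have := N0D _ _ N1 N2; congr N0.
  rewrite !opprD !addrA [LHS](ACl (1*5*4*2*6*3)) [RHS](ACl (2*4*1*3*5*6)) /=.
  by rewrite !subrr !add0r.
have : forall n (p : {poly k}), (size p <= n)%N -> p != 0 ->
    (forall w, N w -> N0 (poly_act X p w)) -> N0 v.
  elim=> [|n IHn] p; first by rewrite leqn0 size_poly_eq0 => ->.
  move=> sp pn0 pN.
  have [dp0|dpn0] := eqVneq p^`() 0.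
    have [c Ep] := deriv_eq0_const char0 dp0.
    have := N0Z c^-1 _ (pN _ Nv); rewrite Ep poly_actC scalerA mulVf ?scale1r //.
    by rewrite -polyC_eq0 -Ep.
  apply: (IHn p^`()) => // [|w Nw].
    by rewrite -ltnS (leq_trans (lt_size_deriv pn0)).
  have N1 := comm p w Nw.
  have N2 := N0D _ _ (N0Y (pN _ Nw)) (N0Z (-1) _ (pN _ (NY Nw))).
  have := N0D _ _ N2 (N0Z (-1) _ N1); congr N0.
  by rewrite !scaleN1r opprB addrC subrK.
by apply; [exact: leqnn| exact: p0n0|move=> w _; rewrite p0X].
Qed.

End WeylSubquotient.

(** In coordinates this is the Cayley-Hamilton theorem. *)
Lemma finite_dim_poly_act (k : fieldType) (V : lmodType k)
  (X : {linear V -> V}) : finite_dim V ->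
  exists2 p : {poly k}, p != 0 & forall v, poly_act X p v = 0.
Proof.
case=> n [phi bij_phi]; have [psi phiK psiK] := bij_phi.
have psi_lin : linear psi.
  by move=> c u v; apply: (can_inj phiK); rewrite linearP !psiK.
case: n phi bij_phi psi phiK psiK psi_lin => [|n] phi bij_phi psi phiK psiK psi_lin.
  (* horner_mx needs a nonempty matrix; on the zero space p = 1 does. *)
  exists 1; first exact: oner_neq0.
  by move=> v; apply: (can_inj phiK); rewrite [LHS]thinmx0 [RHS]thinmx0.
pose f (u : 'rV[k]_n.+1) := phi (X (psi u)).
have f_lin : linear f by move=> c u v; rewrite /f psi_lin !linearP.
pose F := HB.pack_for {linear 'rV[k]_n.+1 -> 'rV[k]_n.+1} f
  (GRing.isLinear.Build _ _ _ _ f f_lin).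
pose M := lin1_mx f.
have fM u : u *m M = f u by exact: (mul_rV_lin1 F).
have actE p v : phi (poly_act X p v) = phi v *m horner_mx M p.
  elim/poly_ind: p v => [|p c IHp] v.
    by rewrite rmorph0 mulmx0 /poly_act size_poly0 big_ord0 linear0.
  rewrite -[p * 'X]scale1r poly_act_linearl scale1r poly_actMX poly_actC.
  rewrite linearD linearZ /= IHp scale1r rmorphD rmorphM /= horner_mx_X.
  rewrite horner_mx_C -[horner_mx M p * M](comm_mx_horner p (erefl _)).
  by rewrite mulmxDr mulmxA fM /f phiK mul_mx_scalar.
exists (char_poly M); first exact/monic_neq0/char_poly_monic.
by move=> v; apply: (can_inj phiK); rewrite actE Cayley_Hamilton mulmx0 linear0.
Qed.

(** * The operations of an envelope *)

Section Envelope.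
Context (k : fieldType) (K : ainf_module (weyl k)) (E : envelope K).
Local Notation x := (weyl_x k).
Local Notation y := (weyl_y k).
Local Notation i := (env_i E).

HB.instance Definition _ :=
  GRing.isLinear.Build k (deg1 K) k *%R (jbar E) (jbar_is_linear E).

Lemma m20_y u b : m20 K (m20 K u b) y = m20 K u (b * y).
Proof. by apply/eqP; rewrite -subr_eq0 m20_assoc env_m3y. Qed.

Lemma m21_y v b : m21 K (m21 K v b) y = m21 K v (b * y).
Proof. by apply/eqP; rewrite -subr_eq0 m21_assoc env_m3y ?linear0. Qed.

Lemma m21_x v b : m21 K (m21 K v x) b = m21 K v (x * b).
Proof. by apply/eqP; rewrite -subr_eq0 m21_assoc env_m3x ?linear0. Qed.

Lemma m20_yx u :
  m20 K (m20 K u y) x = m20 K (m20 K u x) y - u + jbar E (m1 K u) *: i.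
Proof.
have := m20_assoc u y x; rewrite (jbarP E) => /eqP; rewrite subr_eq => /eqP->.
by rewrite addrC weyl_yx linearBr m20_unit m20_y.
Qed.

(** The Calogero-Moser equation: the commutator of the actions of y and x on K^1
    differs from the identity by an operator of rank at most one. *)
Lemma m21_yx v :
  m21 K (m21 K v y) x = m21 K (m21 K v x) y - v + jbar E v *: ibar E.
Proof.
have := m21_assoc v y x; rewrite (jbarP E) linearZ => /eqP.
rewrite subr_eq => /eqP->.
by rewrite addrC weyl_yx linearBr m21_unit m21_y.
Qed.

(** The four identities below are instances of the coherence relation; together
    with the vanishing of m_3 at 1 they compute m_3 on all normally ordered
    arguments from the actions and j. *)
Lemma m3_xl v a b : m3 K v (x * a) b = m3 K (m21 K v x) a b.
Proof.
have := m3_coherence v x a b; rewrite !env_m3x // linear0l addr0 subr0.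
by rewrite addrC => /eqP; rewrite subr_eq0 => /eqP.
Qed.

Lemma m3_yr v a b : m3 K v a (b * y) = m20 K (m3 K v a b) y.
Proof.
have := m3_coherence v a b y; rewrite !env_m3y // oppr0 add0r addr0.
by move=> /eqP; rewrite subr_eq0 => /eqP.
Qed.

Lemma m3_yl v a b : m3 K v (a * y) b = m3 K v a (y * b) + m3 K (m21 K v a) y b.
Proof.
have := m3_coherence v a y b; rewrite (env_m3y E v a) linear0l subr0 -addrA addrC.
by move=> /eqP; rewrite subr_eq0 => /eqP.
Qed.

Lemma m3_y_xl v b :
  m3 K v y (x * b) = m3 K (m21 K v x) y b + jbar E v *: m20 K i b.
Proof.
have := m3_coherence v y x b.
have := m3_linear2 v b (-1) 1 (x * y).
rewrite !scaleN1r m3_unitl oppr0 add0r m3_xl addrC -weyl_yx => ->.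
rewrite (env_m3x E) addr0 (jbarP E) linearZl_LR /= => /eqP.
by rewrite subr_eq0 addrC subr_eq => /eqP ->; rewrite addrC.
Qed.

Lemma m20_surj u : exists a, u = m20 K i a.
Proof. by have [g _ gK] := env_bij E; exists (g u); rewrite gK. Qed.

(** In degree 0 the action of y is right multiplication, so K^0 is generated under
    it by the elements i.x^p, on which x acts by right multiplication too. *)
Lemma m20_xy_ind (S : deg0 K -> Prop) :
  (forall c u v, S u -> S v -> S (c *: u + v)) ->
  (forall p, S (m20 K i (x ^+ p))) ->
  (forall u, S u -> S (m20 K u y)) -> forall u, S u.
Proof.
move=> Slin Sx Sy u; have [a ->] := m20_surj u.
pose T b := forall p, S (m20 K i (x ^+ p * b)).
suff /(_ 0) : T a by rewrite expr0 mul1r.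
elim/weyl_normal_ind: a => [c a b Ta Tb p||a Ta p|a Ta p].
- by rewrite mulrDr -scalerAr linearPr; apply: Slin.
- by move=> p; rewrite mulr1.
- by rewrite mulrA -exprSr; apply: Ta.
- by rewrite mulrA -m20_y; apply/Sy/Ta.
Qed.

Lemma m20_powx p : m20 K (m20 K i (x ^+ p)) x = m20 K i (x ^+ p.+1).
Proof.
suff H : forall q v, m3 K v (x ^+ q) x = 0.
  by apply/eqP; rewrite exprSr -subr_eq0 m20_assoc H.
by elim=> [|q IHq] v; rewrite ?expr0 ?m3_unitl // exprS m3_xl.
Qed.

(** On K^1 / im m_1 the rank one term of the Calogero-Moser equation, a multiple
    of m_1(i), vanishes. *)
Lemma m1_surj (char0 : [pchar k] =i pred0) v : exists u, v = m1 K u.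
Proof.
apply: (@weyl_subquotient_trivial k char0 (deg1 K)
  (applyr (m21 K) x) (applyr (m21 K) y)
  (fun=> True) (fun v => exists u, v = m1 K u)) => //.
- by move=> c _ _ [u ->] [w ->]; exists (c *: u + w); rewrite linearP.
- by move=> _ [u ->]; exists (m20 K u x); rewrite m1_m2.
- by move=> _ [u ->]; exists (m20 K u y); rewrite m1_m2.
- move=> w _; exists (- jbar E w *: i).
  rewrite linearZ /= m21_yx scaleNr opprD addrA subKr.
  by rewrite addrAC subrr add0r.
- by apply: finite_dim_poly_act; exact: env_finite E.
Qed.

End Envelope.

(** * A strict morphism between envelopes with the same functional *)

Section StrictMorphism.
Context (k : fieldType) (char0 : [pchar k] =i pred0).
Context (K L : ainf_module (weyl k)) (E : envelope K) (F : envelope L).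
Context (eq_lambda : lambda E =1 lambda F).
Local Notation x := (weyl_x k).
Local Notation y := (weyl_y k).

(** The maps are forced: phi in degree 0 sends i.a to i'.a, and psi in degree 1 is
    induced by phi along the surjection m_1.  The point is that phi preserves
    ker m_1, and that the two maps commute with m_2 and m_3. *)
Lemma strict_morphism_of_lambda :
  exists f : ainf_mor K L,
    strict f /\ forall a, f10 f (m20 K (env_i E) a) = m20 L (env_i F) a.
Proof.
have [phi phiE] : exists phi : {linear deg0 K -> deg0 L},
    forall a, phi (m20 K (env_i E) a) = m20 L (env_i F) a.
  have [coord coordK coordV] := env_bij E.
  have coord_lin : linear coord.
    by move=> c u v; apply: (can_inj coordK); rewrite linearPr !coordV.
  pose f u := m20 L (env_i F) (coord u).
  have f_lin : linear f by move=> c u v; rewrite /f coord_lin linearPr.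
  exists (HB.pack_for {linear deg0 K -> deg0 L} f
    (GRing.isLinear.Build _ _ _ _ _ f_lin)) => a.
  by rewrite /= /f coordK.
have phi_i : phi (env_i E) = env_i F by rewrite -(m20_unit (env_i E)) phiE m20_unit.
have phi_j u : jbar F (m1 L (phi u)) = jbar E (m1 K u).
  have [a ->] := m20_surj E u; rewrite phiE !m1_m2.
  exact/esym/eq_lambda.
have phi_y u : phi (m20 K u y) = m20 L (phi u) y.
  by have [a ->] := m20_surj E u; rewrite m20_y // !phiE m20_y.
have phi_x u : phi (m20 K u x) = m20 L (phi u) x.
  elim/(m20_xy_ind (E := E)): u => [c u v IHu IHv|p|u IHu].
  - by rewrite linearPl !linearP IHu IHv linearPl.
  - by rewrite m20_powx // !phiE m20_powx.
  - rewrite (m20_yx E) phi_y (m20_yx F) phi_j -IHu addrC linearP.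
    rewrite -[_ - u]addrC -scaleN1r linearP phi_y phi_i addrC scaleN1r.
    by rewrite [- _ + _]addrC.
(* The image of ker m_1 in L^1 is stable under x and y, and the form jbar vanishes
   on it because phi_j gives its values there; so the Weyl relation holds on it
   and it is zero. *)
have phi_ker u : m1 K u = 0 -> m1 L (phi u) = 0.
  move=> u0; apply: (@weyl_subquotient_trivial k char0 (deg1 L)
    (applyr (m21 L) x) (applyr (m21 L) y)
    (fun v => exists2 u, m1 K u = 0 & v = m1 L (phi u)) (fun v => v = 0)).
  - by move=> c u' v' -> ->; rewrite scaler0 addr0.
  - move=> _ [v v0 ->]; exists (m20 K v x); rewrite ?m1_m2 ?v0 ?linear0l //.
    by rewrite phi_x m1_m2.
  - move=> _ [v v0 ->]; exists (m20 K v y); rewrite ?m1_m2 ?v0 ?linear0l //.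
    by rewrite phi_y m1_m2.
  - by move=> _ ->; rewrite linear0.
  - by move=> _ ->; rewrite linear0.
  - move=> _ [v v0 ->] /=; rewrite (m21_yx F) phi_j v0.
    by rewrite (linear0 (jbar E)) scale0r addr0 subKr subrr.
  - by apply: finite_dim_poly_act; exact: env_finite F.
  - by exists u.
have [psi psiE] : exists psi : {linear deg1 K -> deg1 L},
    forall u, psi (m1 K u) = m1 L (phi u).
  (* Any choice of preimages under m_1 will do, by phi_ker. *)
  pose lift v := projT1 (cid (m1_surj E char0 v)).
  have liftE v : m1 K (lift v) = v by rewrite /lift; case: cid => u /= /esym.
  have liftK u : m1 L (phi (lift (m1 K u))) = m1 L (phi u).
    apply/eqP; rewrite -subr_eq0 -!linearB; apply/eqP/phi_ker.
    by rewrite linearB liftE subrr.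
  pose f v := m1 L (phi (lift v)).
  have f_lin : linear f.
    move=> c v w; rewrite /f -[v in LHS](liftE v) -[w in LHS](liftE w) -linearP.
    by rewrite liftK !linearP.
  by exists (HB.pack_for {linear deg1 K -> deg1 L} f
    (GRing.isLinear.Build _ _ _ _ _ f_lin)).
have psi_ind (P : deg1 K -> Prop) : (forall u, P (m1 K u)) -> forall v, P v.
  by move=> PK v; have [u ->] := m1_surj E char0 v.
have psi_j v : jbar F (psi v) = jbar E v.
  by elim/psi_ind: v => u; rewrite psiE phi_j.
have psi_x v : psi (m21 K v x) = m21 L (psi v) x.
  by elim/psi_ind: v => u; rewrite -m1_m2 !psiE phi_x m1_m2.
have psi_y v : psi (m21 K v y) = m21 L (psi v) y.
  by elim/psi_ind: v => u; rewrite -m1_m2 !psiE phi_y m1_m2.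
have psi_m21 v a : psi (m21 K v a) = m21 L (psi v) a.
  elim/weyl_normal_ind: a v => [c a b IHa IHb v|v|a IHa v|a IHa v].
  - by rewrite linearPr linearP IHa IHb linearPr.
  - by rewrite !m21_unit.
  - by rewrite -(m21_x E) IHa psi_x (m21_x F).
  - by rewrite -(m21_y E) psi_y IHa (m21_y F).
have phi_m3y v b : phi (m3 K v y b) = m3 L (psi v) y b.
  elim/weyl_normal_ind: b v => [c a b IHa IHb v|v|a IHa v|a IHa v].
  - by rewrite m3_linear3 linearP IHa IHb m3_linear3.
  - by rewrite !m3_unitr linear0.
  - by rewrite (m3_y_xl E) addrC linearP phiE IHa psi_x (m3_y_xl F) psi_j addrC.
  - by rewrite (m3_yr E) phi_y IHa (m3_yr F).
have phi_m3 v a b : phi (m3 K v a b) = m3 L (psi v) a b.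
  elim/weyl_normal_ind: a v b => [c a a' IHa IHa' v b|v b|a IHa v b|a IHa v b].
  - by rewrite m3_linear2 linearP IHa IHa' m3_linear2.
  - by rewrite !m3_unitl linear0.
  - by rewrite (m3_xl E) IHa psi_x (m3_xl F).
  - by rewrite (m3_yl E) linearD IHa phi_m3y (m3_yl F) psi_m21.
(* i.b.a - i.(b a) is a value of m_3, so this follows from phi_m3. *)
have phi_m20 u a : phi (m20 K u a) = m20 L (phi u) a.
  have [b ->] := m20_surj E u.
  have -> : m20 K (m20 K (env_i E) b) a =
      1 *: m20 K (env_i E) (b * a) + m3 K (m1 K (env_i E)) b a.
    by rewrite -m20_assoc scale1r addrC subrK.
  rewrite linearP !phiE phi_m3 psiE phi_i -m20_assoc scale1r.
  by rewrite addrC subrK.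
pose z2 (v : deg1 K) (a : weyl k) : deg0 L := 0.
have z2_bilin : bilinear_for *:%R *:%R z2.
  by split=> [a c u v|v c a b]; rewrite /z2 /= scaler0 addr0.
pose z2L := HB.pack_for {bilinear deg1 K -> weyl k -> deg0 L} z2
  (bilinear_isBilinear.Build _ _ _ _ _ _ _ z2_bilin).
unshelve eexists (@AinfMor k _ K L phi psi z2L _ _ _ _).
- by move=> u; rewrite /= psiE.
- by move=> u a; rewrite /= phi_m20 subrr.
- by move=> v a; rewrite /= psi_m21 subrr linear0.
- by move=> v a b; rewrite /= /z2 linear0l add0r subrr add0r phi_m3.
- by split.
Qed.

End StrictMorphism.

(** * Bivariate polynomials as a vector space over the base field *)

Section Bipoly.
Context (k : fieldType).

(** Elements stand for normally ordered elements of the Weyl algebra: the outer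
    variable is x, the inner one y.  The copy of the type is made because
    {poly {poly k}} carries its scaling by {poly k}, whereas all the maps below
    are only k-linear. *)
Definition bipoly : Type := {poly {poly k}}.
HB.instance Definition _ := GRing.IntegralDomain.on bipoly.

Definition bX : bipoly := 'X.
Definition bY : bipoly := 'X%:P.

Definition bscale (c : k) (b : bipoly) : bipoly := c%:P%:P * b.

Fact bscaleA c d b : bscale c (bscale d b) = bscale (c * d) b.
Proof. by rewrite /bscale mulrA !polyCM. Qed.
Fact bscale1 : left_id 1 bscale.
Proof. by move=> b; rewrite /bscale mul1r. Qed.
Fact bscaleDr : right_distributive bscale +%R.
Proof. by move=> c a b; rewrite /bscale mulrDr. Qed.
Fact bscaleDl b : {morph bscale^~ b : c d / c + d}.
Proof. by move=> c d; rewrite /bscale !polyCD mulrDl. Qed.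

HB.instance Definition _ := GRing.Zmodule_isLmodule.Build k bipoly
  bscaleA bscale1 bscaleDr bscaleDl.
Fact bscaleAl (c : k) (a b : bipoly) : c *: (a * b) = (c *: a) * b.
Proof. exact: mulrA. Qed.
HB.instance Definition _ := GRing.Lmodule_isLalgebra.Build k bipoly bscaleAl.
Fact bscaleAr (c : k) (a b : bipoly) : c *: (a * b) = a * (c *: b).
Proof. exact: mulrCA. Qed.
HB.instance Definition _ := GRing.Lalgebra_isAlgebra.Build k bipoly bscaleAr.

Lemma bcoefZ c (b : bipoly) m : (c *: b : bipoly)`_m = c *: b`_m.
Proof. by rewrite [c *: b]/(c%:P%:P * b) coefCM mul_polyC. Qed.

Definition xsize (b : bipoly) : nat := size (b : {poly {poly k}}).
Definition ysize (b : bipoly) : nat := sizeY (b : {poly {poly k}}).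
Implicit Types a b : bipoly.

(** Exchanging x and y turns each statement on the degree in y into the one on the
    degree in x. *)
Definition bswap b : bipoly := swapXY (b : {poly {poly k}}).

Lemma bswap_lin c a b : bswap (c *: a + b) = c *: bswap a + bswap b.
Proof.
rewrite /bswap [LHS]raddfD; congr (_ + _).
by rewrite /= [c *: a]/(c%:P%:P * a) rmorphM /= swapXY_polyC map_polyC.
Qed.
HB.instance Definition _ :=
  GRing.isLinear.Build k bipoly bipoly *:%R bswap bswap_lin.

Lemma bswapM a b : bswap (a * b) = bswap a * bswap b.
Proof. exact: rmorphM. Qed.

Lemma bswapK : involutive bswap.
Proof. exact: swapXYK. Qed.

Lemma bswapX : bswap bX = bY.
Proof. exact: swapXY_X. Qed.

Lemma bswapY : bswap bY = bX.
Proof. exact: swapXY_Y. Qed.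

Lemma bswapC c : bswap (c *: 1) = c *: 1.
Proof. by rewrite linearZ; congr (_ *: _); apply: rmorph1. Qed.

Lemma ysizeE b : ysize b = xsize (bswap b).
Proof. exact: sizeYE. Qed.

Lemma xsize_eq0 b : (xsize b == 0%N) = (b == 0).
Proof. exact: size_poly_eq0. Qed.

Lemma ysize_eq0 b : (ysize b == 0%N) = (b == 0).
Proof. exact: sizeY_eq0. Qed.

Lemma xsize_lin n c a b :
  (xsize a <= n -> xsize b <= n -> xsize (c *: a + b)%R <= n)%N.
Proof.
move=> an bn; apply: leq_trans (size_polyD _ _) _; rewrite geq_max [X in _ && X]bn andbT.
by apply/leq_sizeP => m le_nm; rewrite bcoefZ nth_default ?scaler0 ?(leq_trans an).
Qed.

Lemma ysize_lin n c a b :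
  (ysize a <= n -> ysize b <= n -> ysize (c *: a + b)%R <= n)%N.
Proof. by rewrite !ysizeE linearP; apply: xsize_lin. Qed.

Lemma xsizeM a b : a != 0 -> b != 0 -> xsize (a * b) = (xsize a + xsize b).-1.
Proof. exact: size_mul. Qed.

Lemma ysizeM a b : a != 0 -> b != 0 -> ysize (a * b) = (ysize a + ysize b).-1.
Proof.
by rewrite -!ysize_eq0 !ysizeE !xsize_eq0 bswapM; apply: xsizeM.
Qed.

Lemma xsizeX : xsize bX = 2%N. Proof. exact: size_polyX. Qed.

Lemma xsizeY : xsize bY = 1%N.
Proof. by rewrite /xsize size_polyC polyX_eq0. Qed.

Lemma xsizeXM n b : (xsize (bX * b)%R <= n.+1)%N = (xsize b <= n)%N.
Proof.
have [->|bn0] := eqVneq b 0; first by rewrite mulr0 /xsize size_poly0.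
by rewrite xsizeM // -?xsize_eq0 xsizeX.
Qed.

Lemma xsizeYM b : xsize (bY * b) = xsize b.
Proof.
have [->|bn0] := eqVneq b 0; first by rewrite mulr0.
by rewrite xsizeM // -?xsize_eq0 xsizeY.
Qed.

Lemma ysizeXM b : ysize (bX * b) = ysize b.
Proof. by rewrite !ysizeE bswapM bswapX xsizeYM. Qed.

Lemma ysizeYM n b : (ysize (bY * b)%R <= n.+1)%N = (ysize b <= n)%N.
Proof. by rewrite !ysizeE bswapM bswapY xsizeXM. Qed.

Lemma xsizeC c : (xsize (c *: 1)%R <= 1)%N.
Proof. by rewrite /xsize [c *: 1]mulr1 size_polyC leq_b1. Qed.

Lemma ysizeC c : (ysize (c *: 1)%R <= 1)%N.
Proof. by rewrite ysizeE bswapC xsizeC. Qed.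

Lemma ysize0 : ysize (0 : bipoly) = 0%N.
Proof. by apply/eqP; rewrite ysize_eq0. Qed.

Lemma xsize0 : xsize (0 : bipoly) = 0%N.
Proof. by apply/eqP; rewrite xsize_eq0. Qed.

Lemma ysize_powX p : ysize (bX ^+ p : bipoly) = 1%N.
Proof.
elim: p => [|p IHp]; last by rewrite exprS ysizeXM.
by rewrite expr0 ysizeE -[1]scale1r bswapC /xsize scale1r size_poly1.
Qed.

Lemma ysize_mono p s : ysize (bX ^+ p * bY ^+ s : bipoly) = s.+1.
Proof.
have bY0 : bY ^+ s != 0 :> bipoly.
  by rewrite expf_neq0 // -xsize_eq0 xsizeY.
have bX0 : bX ^+ p != 0 :> bipoly by rewrite -ysize_eq0 ysize_powX.
rewrite ysizeM // ysize_powX add1n /=.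
elim: s {bY0} => [|s IHs]; first exact: (ysize_powX 0).
have bY0 : bY ^+ s != 0 :> bipoly by rewrite -ysize_eq0 IHs.
rewrite exprS ysizeM ?IHs // -?ysize_eq0; last by rewrite ysizeE bswapY xsizeX.
by rewrite ysizeE bswapY xsizeX.
Qed.

Lemma size1_scalar b : (xsize b <= 1)%N -> (ysize b <= 1)%N -> exists c, b = c *: 1.
Proof.
move=> xb yb; exists b`_0`_0; rewrite [_ *: 1]mulr1.
have {1}-> : b = (b`_0)%:P by apply: size1_polyC.
congr (_%:P); apply: size1_polyC.
exact: leq_trans (max_size_coefXY _ _) yb.
Qed.

(** The quotient of b by y; the remainder is a polynomial in x alone. *)
Definition ydrop b : bipoly := bswap (drop_poly 1 (bswap b)).

Lemma ydrop_lin c a b : ydrop (c *: a + b) = c *: ydrop a + ydrop b.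
Proof.
rewrite /ydrop linearP drop_polyD -linearP; congr (bswap (_ + _)).
by apply/polyP => i; rewrite bcoefZ !coef_drop_poly bcoefZ.
Qed.
HB.instance Definition _ :=
  GRing.isLinear.Build k bipoly bipoly *:%R ydrop ydrop_lin.

Lemma ysize_ydrop b : ysize (ydrop b) = (ysize b).-1.
Proof. by rewrite !ysizeE bswapK [LHS]size_drop_poly subn1. Qed.

Lemma ysize_sub_ydrop b : (ysize (b - bY * ydrop b)%R <= 1)%N.
Proof.
rewrite ysizeE linearB /= bswapM bswapY bswapK.
rewrite -{1}(poly_take_drop 1 (bswap b)) expr1 mulrC addrK.
exact: size_take_poly.
Qed.

(** An induction that respects the filtration by the degree in y, as needed to
    transport degree estimates from monomials to polynomials. *)
Lemma ysize_ind n (S : bipoly -> Prop) : S 0 ->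
  (forall c a b, S a -> S b -> S (c *: a + b)) ->
  (forall p s, (s < n)%N -> S (bX ^+ p * bY ^+ s)) ->
  forall b, (ysize b <= n)%N -> S b.
Proof.
move=> S0 Slin Smon b bn.
have Ssum m (F : 'I_m -> bipoly) : (forall i, S (F i)) -> S (\sum_(i < m) F i).
  move=> SF; elim/big_ind: _ => // a a' Sa Sa'.
  by have := Slin 1 a a' Sa Sa'; rewrite scale1r.
rewrite -[b](@coefK) poly_def; apply: (Ssum) => i.
set r := _`_i; have rn : (size r <= n)%N := leq_trans (max_size_coefXY _ _) bn.
rewrite -mul_polyC -[r]coefK poly_def rmorph_sum /= mulr_suml; apply: (Ssum) => j.
rewrite -[r`_j *: _]mul_polyC rmorphM rmorphXn /= -[_ * _ * _]mulrA [X in _ * X]mulrC.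
have := Slin r`_j _ _ (Smon i j (leq_trans (ltn_ord j) rn)) S0.
by rewrite addr0.
Qed.

Lemma bipoly_cons_ind (S : bipoly -> Prop) : S 0 ->
  (forall b (r : {poly k}), S b -> S (bX * b + r%:P)) -> forall b, S b.
Proof.
move=> S0 SX; elim/poly_ind => [|b r IHb]; first exact: S0.
by rewrite mulrC; apply: SX.
Qed.

End Bipoly.

(** * Normal ordering *)

Section NormalOrdering.
Context (k : fieldType) (A : algType k) (x y : A) (rel_xy : x * y - y * x = 1).
Local Notation B := (bipoly k).

(** The linear map sending the commutative monomial x^p y^q to the word x^p y^q. *)
Definition normal_order (b : B) : A :=
  foldr (fun r a => horner_alg y r + x * a) 0 (b : seq _).

Lemma normal_order_cons (b : B) (r : {poly k}) :
  normal_order (bX k * b + r%:P : B) = x * normal_order b + horner_alg y r.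
Proof.
rewrite /bX mulrC -cons_poly_def /normal_order polyseq_cons nil_poly.
have [->|_] := eqVneq (b : {poly {poly k}}) 0; last exact: addrC.
rewrite polyseq0 polyseqC.
have [->|_] := eqVneq r 0; rewrite [foldr _ _ _]/=.
  by rewrite rmorph0 addr0 mulr0.
by rewrite /= !mulr0 addr0 add0r.
Qed.

Lemma normal_order0 : normal_order 0 = 0.
Proof. by rewrite /normal_order polyseq0. Qed.

Lemma normal_order_lin c a b :
  normal_order (c *: a + b) = c *: normal_order a + normal_order b.
Proof.
elim/bipoly_cons_ind: a b => [|a r IHa] b.
  by rewrite scaler0 add0r normal_order0 scaler0 add0r.
elim/poly_ind: b => [|b s _].
  rewrite addr0 normal_order0 addr0.
  have -> : c *: (bX k * a + r%:P : B) = bX k * (c *: a + 0) + (c *: r)%:P.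
    rewrite addr0 scalerDr scalerAr; congr (_ + _).
    by rewrite -mul_polyC polyCM.
  rewrite !normal_order_cons IHa normal_order0 addr0.
  by rewrite linearZ /= mulr_algl [RHS]scalerDr scalerAr. 
have -> : c *: (bX k * a + r%:P : B) + (b * 'X + s%:P : B) =
    bX k * (c *: a + b) + (c *: r + s)%:P.
  rewrite mulrDr -scalerAr polyCD scalerDr -!addrA; congr (_ + _).
  rewrite [LHS]addrCA [b * 'X]mulrC; congr (_ + (_ + _)).
  by rewrite -mul_polyC polyCM.
rewrite [b * _ in RHS]mulrC !normal_order_cons IHa linearP /= mulr_algl mulrDr.
by rewrite [in RHS]scalerDr [in RHS]scalerAr addrACA.
Qed.

HB.instance Definition _ :=
  GRing.isLinear.Build k B A *:%R normal_order normal_order_lin.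

Lemma normal_order_X b : normal_order (bX k * b) = x * normal_order b.
Proof. by have := normal_order_cons b 0; rewrite addr0 rmorph0 addr0. Qed.

Lemma normal_order_C (r : {poly k}) : normal_order (r%:P) = horner_alg y r.
Proof.
by have := normal_order_cons 0 r; rewrite mulr0 add0r normal_order0 mulr0 add0r.
Qed.

Lemma normal_order_1 : normal_order 1 = 1.
Proof. by have := normal_order_C 1; rewrite polyC1 rmorph1. Qed.

Lemma normal_order_Y b : normal_order (bY k * b) = normal_order b * y.
Proof.
elim/bipoly_cons_ind: b => [|b r IHb]; first by rewrite mulr0 linear0 mul0r.
rewrite mulrDr mulrCA -polyCM !normal_order_cons IHb mulrDl mulrA; congr (_ + _).
by rewrite [_ * r]mulrC rmorphM /= horner_algX.
Qed.

Lemma normal_order_deriv b :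
  normal_order (b^`() : {poly {poly k}}) = normal_order b * y - y * normal_order b.
Proof.
have yx : y * x = x * y - 1 by rewrite -rel_xy subKr.
elim/bipoly_cons_ind: b => [|b r IHb].
  by rewrite deriv0 linear0 mul0r mulr0 subrr.
rewrite derivD derivC addr0 derivM derivX mul1r normal_order_cons.
have -> : normal_order (b + bX k * b^`()) = normal_order b + x * normal_order b^`().
  by rewrite -normal_order_X; apply: linearD.
rewrite IHb mulrBr mulrDl mulrDr.
have -> : horner_alg y r * y = y * horner_alg y r.
  by have := rmorphM (horner_alg y) 'X r; rewrite mulrC rmorphM /= horner_algX.
rewrite [y * (x * _) + _]addrC addrKA !mulrA yx mulrBl mul1r opprB.
by rewrite addrCA.
Qed.

Lemma horner_alg_deriv (r : {poly k}) :
  horner_alg y r^`() = x * horner_alg y r - horner_alg y r * x.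
Proof.
have yx : y * x = x * y - 1 by rewrite -rel_xy subKr.
elim/poly_ind: r => [|r c IHr].
  by rewrite deriv0 !rmorph0 mulr0 mul0r subrr.
rewrite derivD derivC addr0 derivM derivX mulr1 !rmorphD !rmorphM /= horner_algX.
rewrite horner_algC IHr mulrBl mulrDr mulrDl mulr_algl mulr_algr.
rewrite opprD addrACA subrr addr0.
by rewrite -!mulrA yx mulrBr mulr1 opprB [in RHS]addrA addrAC.
Qed.

(** The kernel is stable under both partial derivations, which are commutators
    with y and x; so in characteristic zero a nonzero element of it could be
    differentiated down to a nonzero constant. *)
Lemma normal_order_inj : [pchar k] =i pred0 -> injective normal_order.
Proof.
move=> char0; suff ker0 b : normal_order b = 0 -> b = 0.
  move=> a b eq_ab; apply/eqP; rewrite -subr_eq0; apply/eqP/ker0.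
  by rewrite linearB /= eq_ab subrr.
have kerC n : forall r : {poly k}, (size r <= n)%N -> horner_alg y r = 0 -> r = 0.
  elim: n => [|n IHn] r; first by rewrite leqn0 size_poly_eq0 => /eqP.
  move=> sr r0; apply/eqP; apply: contraT => rn0.
  have [c Ec] : exists c, r = c%:P.
    apply: deriv_eq0_const char0 _; apply: IHn.
      by rewrite -ltnS (leq_trans (lt_size_deriv rn0)).
    by rewrite horner_alg_deriv r0 mulr0 mul0r subrr.
  move: r0; rewrite Ec horner_algC => /eqP; rewrite scaler_eq0 oner_eq0 orbF.
  by move=> /eqP c0; rewrite Ec c0 polyC0 eqxx in rn0.
have pchar0 : [pchar {poly k}] =i pred0 by move=> p; rewrite pchar_poly.
have: forall n (b : {poly {poly k}}), (size b <= n)%N -> normal_order b = 0 -> b = 0.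
  elim=> [|n IHn] c; first by rewrite leqn0 size_poly_eq0 => /eqP.
  move=> sc c0; apply/eqP; apply: contraT => cn0.
  have [r Er] : exists r, c = r%:P.
    apply: deriv_eq0_const pchar0 _; apply: IHn.
      by rewrite -ltnS (leq_trans (lt_size_deriv cn0)).
    by rewrite normal_order_deriv c0 mulr0 mul0r subrr.
  move: c0; rewrite Er normal_order_C => /(kerC _ _ (leqnn _)) r0.
  by rewrite Er r0 polyC0 eqxx in cn0.
by move=> /(_ _ b (leqnn _)).
Qed.

End NormalOrdering.

(** * Envelopes and their morphisms as data on bivariate polynomials *)

(** An envelope with K^0 identified with k[x,y]: cm_sp is K^1, cm_mu is m_1, y acts on
    k[x,y] by multiplication and cm_theta is the action of x.  The scalar
    polynomial 1 stands for the generator i; cm_thetaY and cm_comm are the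
    Calogero-Moser equation in degrees 0 and 1. *)
Record cm_datum (k : fieldType) := CMDatum {
  cm_sp : lmodType k;
  cm_X : {linear cm_sp -> cm_sp};
  cm_Y : {linear cm_sp -> cm_sp};
  cm_j : {scalar cm_sp};
  cm_mu : {linear bipoly k -> cm_sp};
  cm_theta : {linear bipoly k -> bipoly k};
  cm_muX : forall b, cm_mu (cm_theta b) = cm_X (cm_mu b);
  cm_muY : forall b, cm_mu (bY k * b) = cm_Y (cm_mu b);
  cm_theta_powX : forall p, cm_theta (bX k ^+ p) = bX k ^+ p.+1;
  cm_thetaY : forall b,
    cm_theta (bY k * b) = bY k * cm_theta b - b + cm_j (cm_mu b) *: 1;
  cm_comm : forall v,
    cm_Y (cm_X v) - cm_X (cm_Y v) = v - cm_j v *: cm_mu 1;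
  cm_finite : finite_dim cm_sp
}.

(** What remains of a morphism of envelopes: cm_F and cm_f are f_1 in degrees 0
    and 1, while cm_p and cm_q are f_2(-, x) and f_2(-, y).  The equation cm_pq
    expresses that the two ways of computing f_2(v, y x) = f_2(v, x y) agree. *)
Record cm_mor (k : fieldType) (D D' : cm_datum k) := CMMor {
  cm_F : {linear bipoly k -> bipoly k};
  cm_f : {linear cm_sp D -> cm_sp D'};
  cm_p : {linear cm_sp D -> bipoly k};
  cm_q : {linear cm_sp D -> bipoly k};
  cm_F_mu : forall b, cm_mu D' (cm_F b) = cm_f (cm_mu D b);
  cm_F_theta : forall b,
    cm_F (cm_theta D b) = cm_theta D' (cm_F b) + cm_p (cm_mu D b);
  cm_F_Y : forall b, cm_F (bY k * b) = bY k * cm_F b + cm_q (cm_mu D b);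
  cm_pq : forall v,
    bY k * cm_p v + cm_q (cm_X D v)
    = cm_theta D' (cm_q v) + cm_p (cm_Y D v)
      + cm_j D' (cm_f v) *: 1 - cm_j D v *: cm_F 1
}.

Section MulY.
Context (k : fieldType).
Definition mulY (b : bipoly k) : bipoly k := bY k * b.
Lemma mulY_linear : linear mulY.
Proof. by move=> c a b; rewrite /mulY mulrDr scalerAr. Qed.
HB.instance Definition _ :=
  GRing.isLinear.Build k (bipoly k) (bipoly k) *:%R mulY mulY_linear.
End MulY.

Section Homotopy.
Context (k : fieldType) (D D' : cm_datum k) (g : cm_mor D D').

(** The usual change of a morphism by a homotopy h : K^1 -> L^0. *)
Lemma cm_homotopy (h : {linear cm_sp D -> bipoly k}) : exists g' : cm_mor D D',
  (forall b, cm_F g' b = cm_F g b + h (cm_mu D b)) /\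
  (forall v, cm_q g' v = cm_q g v + (h (cm_Y D v) - bY k * h v)).
Proof.
pose p' : {linear cm_sp D -> bipoly k} :=
  (cm_p g \+ ((h \o cm_X D) \- (cm_theta D' \o h)))%R.
pose q' : {linear cm_sp D -> bipoly k} :=
  (cm_q g \+ ((h \o cm_Y D) \- (@mulY k \o h)))%R.
pose F' : {linear bipoly k -> bipoly k} := (cm_F g \+ (h \o cm_mu D))%R.
pose f' : {linear cm_sp D -> cm_sp D'} := (cm_f g \+ (cm_mu D' \o h))%R.
unshelve eexists (@CMMor k D D' F' f' p' q' _ _ _ _).
- by move=> b; rewrite /= linearD cm_F_mu.
- move=> b; rewrite /= linearD cm_F_theta cm_muX !addrA.
  by rewrite [RHS](ACl (1*3*4*2*5)) /= addrK.
- move=> b; rewrite /= /mulY mulrDr cm_F_Y cm_muY !addrA.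
  by rewrite [RHS](ACl (1*3*4*2*5)) /= addrK.
- move=> v; rewrite /= /mulY.
  have := congr1 h (cm_comm v); rewrite !linearB /= linearZ /= => hcomm.
  have thY := cm_thetaY D' (h v).
  rewrite !mulrDr !linearD !linearN /= !mulrN thY scalerDl.
  have hyx : h (cm_Y D (cm_X D v)) =
      h (cm_X D (cm_Y D v)) + (h v - cm_j D v *: h (cm_mu D 1)).
    by rewrite -hcomm addrC subrK.
  have pq := cm_pq g v; have pv : bY k * cm_p g v =
      cm_theta D' (cm_q g v) + cm_p g (cm_Y D v) + (cm_j D' (cm_f g v))%:A -
        cm_j D v *: cm_F g 1 - cm_q g (cm_X D v).
    by rewrite -pq addrK.
  by rewrite hyx pv; ring.
- by split.
Qed.

End Homotopy.

(** * Degree estimates *)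

(** Here sz is any size whose bounded parts are subspaces. *)
Lemma finite_dim_bounded (k : fieldType) (V : lmodType k) (W : lmodType k)
  (sz : W -> nat) (g : {linear V -> W}) :
  (forall n c a b, (sz a <= n -> sz b <= n -> sz (c *: a + b)%R <= n)%N) ->
  finite_dim V -> exists N, forall v, (sz (g v) <= N)%N.
Proof.
move=> sz_lin [n [phi [psi phiK psiK]]].
have psi_lin : linear psi.
  by move=> c u v; apply: (can_inj phiK); rewrite linearP !psiK.
pose G := HB.pack_for {linear 'rV[k]_n -> V} psi
  (GRing.isLinear.Build _ _ _ _ _ psi_lin).
pose e i := sz (g (psi (delta_mx 0 i))).
pose M := maxn (sz 0) (\max_i e i); exists M => v.
rewrite -(phiK v) [phi v]row_sum_delta [psi _](linear_sum G) linear_sum.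
have szM0 : (sz 0%R <= M)%N by exact: leq_maxl.
apply: (big_ind (fun w => (sz w <= M)%N)) => // [a b sa sb|i _].
  by rewrite -[a]scale1r; apply: sz_lin.
rewrite !linearZ /= -[_ *: _]addr0; apply: sz_lin => //.
by rewrite leq_max (leq_bigmax i) orbT.
Qed.

Section Descent.
Context (k : fieldType) (T : Type) (sz : bipoly k -> nat) (m : bipoly k).
Context (sz_lin : forall n c (a b : bipoly k),
  (sz a <= n -> sz b <= n -> sz (c *: a + b)%R <= n)%N).
Context (szM : forall n b, (sz (m * b)%R <= n.+1)%N = (sz b <= n)%N).

(** Where p(v) is nonzero of the largest size n, the term m p(v) has size n + 1 and
    cannot be compensated by p(t(v)), so that n + 1 <= d. *)
Lemma size_descent (t : T -> T) (p : T -> bipoly k) d :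
  (exists N, forall v, (sz (p v) <= N)%N) ->
  (forall v, (sz (m * p v - p (t v))%R <= d)%N) ->
  forall v, (sz (p v) <= d.-1)%N.
Proof.
case=> N; elim: N => [|N IHN] pN rd v; first exact: leq_trans (pN v) _.
have [le_Nd|lt_dN] := leqP N.+1 d.-1; first exact: leq_trans (pN v) _.
apply: (IHN _ rd) => w; rewrite -szM -(subrK (p (t w)) (m * p w)).
rewrite -[_ - _]scale1r; apply: sz_lin; last exact: pN.
by apply: leq_trans (rd w) _; case: (d) lt_dN.
Qed.

End Descent.

Section Datum.
Context (k : fieldType) (D : cm_datum k).
Local Notation B := (bipoly k).
Local Notation bX := (bX k).
Local Notation bY := (bY k).

Lemma cm_theta_X b : (ysize b <= 1)%N -> cm_theta D b = bX * b.
Proof.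
apply: (ysize_ind (S := fun b => cm_theta D b = bX * b)).
- by rewrite linear0 mulr0.
- by move=> c a a' IHa IHa'; rewrite linearP IHa IHa' mulrDr scalerAr.
- by move=> p [|//] _; rewrite expr0 mulr1 cm_theta_powX exprS.
Qed.

(** The action of x is multiplication by x up to terms of smaller y-degree. *)
Lemma ysize_theta_defect n b :
  (ysize b <= n)%N -> (ysize (cm_theta D b - bX * b)%R <= n.-1)%N.
Proof.
move: b; pose S b := (ysize (cm_theta D b - bX * b)%R <= n.-1)%N.
apply: (ysize_ind (S := S)) => [|c a a' IHa IHa'|p s lt_sn].
- by rewrite /S linear0 mulr0 subr0 ysize0.
- rewrite /S linearP mulrDr -scalerAr.
  have -> : c *: cm_theta D a + cm_theta D a' - (c *: (bX * a) + bX * a') =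
    c *: (cm_theta D a - bX * a) + (cm_theta D a' - bX * a').
    by rewrite scalerBr opprD addrACA.
  exact: ysize_lin.
rewrite /S; apply: (@leq_trans s); last by rewrite -ltnS (ltn_predK lt_sn).
elim: s {lt_sn} => [|s IHs].
  by rewrite expr0 mulr1 cm_theta_powX -exprS subrr ysize0.
rewrite exprS mulrCA cm_thetaY [bX * (bY * _)]mulrCA.
set b := bX ^+ p * _ in IHs *.
have -> : bY * cm_theta D b - b + (cm_j D (cm_mu D b))%:A - bY * (bX * b) =
    1 *: (bY * (cm_theta D b - bX * b)) +
    ((-1) *: b + cm_j D (cm_mu D b) *: 1).
  by rewrite scale1r scaleN1r; ring.
apply: ysize_lin; first by rewrite ysizeYM.
apply: ysize_lin; first by rewrite ysize_mono.
exact: leq_trans (ysizeC _) _.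
Qed.

Lemma cm_mu_powX (r : {poly k}) :
  cm_mu D (map_poly polyC r : B) = poly_act (cm_X D) r (cm_mu D 1).
Proof.
have ysz (q : {poly k}) : (ysize (map_poly polyC q : B) <= 1)%N.
  by rewrite /ysize sizeYE -swapXY_polyC swapXYK size_polyC leq_b1.
elim/poly_ind: r => [|r c IHr].
  by rewrite rmorph0 linear0 /poly_act size_poly0 big_ord0.
rewrite -[r * 'X]scale1r poly_act_linearl !scale1r poly_actMX poly_act_comm -IHr.
rewrite -cm_muX cm_theta_X // poly_actC -[c *: _]linearZ -[RHS]linearD.
congr (cm_mu D _); rewrite rmorphD rmorphM /= map_polyX map_polyC /= [_ * 'X]mulrC.
by congr (_ + _); rewrite [_ *: 1]mulr1.
Qed.

Lemma cm_mu_powY (r : {poly k}) :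
  cm_mu D (r%:P : B) = poly_act (cm_Y D) r (cm_mu D 1).
Proof.
elim/poly_ind: r => [|r c IHr].
  by rewrite linear0 /poly_act size_poly0 big_ord0.
rewrite -[r * 'X]scale1r poly_act_linearl !scale1r poly_actMX poly_act_comm -IHr.
rewrite -cm_muY poly_actC -[c *: _]linearZ -[RHS]linearD.
congr (cm_mu D _); rewrite polyCD polyCM [_ * 'X%:P]mulrC.
by congr (_ + _); rewrite [_ *: 1]mulr1.
Qed.

(** As m_1(i.p(x)) = p(X) m_1(i), any polynomial killing X gives an element of the
    kernel of m_1; likewise for y. *)
Lemma cm_mu_ker_x : exists2 w : B, w != 0 & (ysize w <= 1)%N /\ cm_mu D w = 0.
Proof.
have [r rn0 r0] := finite_dim_poly_act (cm_X D) (cm_finite D).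
exists (map_poly polyC r); first by rewrite map_poly_eq0.
split; last by rewrite cm_mu_powX r0.
by rewrite /ysize sizeYE -swapXY_polyC swapXYK size_polyC leq_b1.
Qed.

Lemma cm_mu_ker_y : exists2 w : B, w != 0 & (xsize w <= 1)%N /\ cm_mu D w = 0.
Proof.
have [r rn0 r0] := finite_dim_poly_act (cm_Y D) (cm_finite D).
exists (r%:P); first by rewrite polyC_eq0.
by split; [rewrite /xsize size_polyC leq_b1|rewrite cm_mu_powY r0].
Qed.

End Datum.

(** * Rigidity of morphisms *)

Section Rigidity.
Context (k : fieldType) (D D' : cm_datum k).
Local Notation B := (bipoly k).
Local Notation bX := (bX k).
Local Notation bY := (bY k).
Implicit Types (g : cm_mor D D') (b : B).

(** Every homotopy h changes f_2(v, y) by h(v.y) - h(v) y.  Taking for h the quotient of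
    f_2(-, y) by y leaves the remainder, a polynomial in x, and a term of smaller
    y-degree; the degrees are bounded on the finite-dimensional space K^1, so the
    process stops. *)
Lemma cm_normalize g : exists (g' : cm_mor D D') (h : {linear cm_sp D -> B}),
  (forall b, cm_F g' b = cm_F g b + h (cm_mu D b)) /\
  (forall v, (ysize (cm_q g' v) <= 1)%N).
Proof.
suff norm : forall n (q : {linear cm_sp D -> B}),
    (forall v, (ysize (q v) <= n.+1)%N) -> exists h : {linear cm_sp D -> B},
    forall v, (ysize (q v + (h (cm_Y D v) - bY * h v))%R <= 1)%N.
  have [n qn] := finite_dim_bounded (cm_q g) (@ysize_lin k) (cm_finite D).
  have [h hq] := norm n (cm_q g) (fun v => leqW (qn v)).
  have [g' [Fg' qg']] := cm_homotopy g h.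
  by exists g', h; split=> // v; rewrite qg'.
elim=> [|n IHn] q qn.
  exists \0%R => v /=; rewrite mulr0 subrr addr0; exact: qn.
pose q1 : {linear cm_sp D -> B} := @ydrop k \o q.
have q1n v : (ysize (q1 v) <= n.+1)%N.
  by rewrite /= ysize_ydrop; have := qn v; case: ysize.
pose r : {linear cm_sp D -> B} := ((q \- (@mulY k \o q1)) \+ (q1 \o cm_Y D))%R.
have rn v : (ysize (r v) <= n.+1)%N.
  rewrite /r /= -[q v - _]scale1r; apply: ysize_lin; last exact: q1n.
  exact: leq_trans (ysize_sub_ydrop _) _.
have [h hr] := IHn r rn; exists (q1 \+ h)%R => v.
have := hr v; rewrite /r /= /mulY; congr ((ysize _ <= _)%N).
by ring.
Qed.

Section Normalized.
Context (g : cm_mor D D').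
Context (q_ysize : forall v, (ysize (cm_q g v) <= 1)%N).
Local Notation c := (cm_F g 1).

(** The difference between cm_F and multiplication by c = cm_F 1, which turns out
    to have smaller degree. *)
Let defect b := cm_F g b - c * b.

Lemma defect_lin a b b' : defect (a *: b + b') = a *: defect b + defect b'.
Proof. by rewrite /defect linearP mulrDr -scalerAr scalerBr opprD addrACA. Qed.

Lemma cm_p_rec v : bY * cm_p g v - cm_p g (cm_Y D v) =
  (bX * cm_q g v - cm_q g (cm_X D v)) +
  (cm_j D' (cm_f g v) *: 1 - cm_j D v *: c).
Proof.
have := cm_pq g v; rewrite cm_theta_X // => E.
have -> : bY * cm_p g v = bX * cm_q g v + cm_p g (cm_Y D v) +
    (cm_j D' (cm_f g v))%:A - cm_j D v *: c - cm_q g (cm_X D v).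
  by rewrite -E addrK.
by ring.
Qed.

Lemma cm_p_ysize n : (0 < n)%N -> (ysize c <= n)%N ->
  forall v, (ysize (cm_p g v) <= n.-1)%N.
Proof.
move=> n_gt0 cn; apply: (size_descent (@ysize_lin k) (@ysizeYM k) (t := cm_Y D)).
  exact: finite_dim_bounded (@ysize_lin k) (cm_finite D).
move=> v; rewrite cm_p_rec -[X in X + _]scale1r; apply: ysize_lin.
  rewrite addrC -scaleN1r; apply: ysize_lin.
    exact: leq_trans (q_ysize _) _.
  by rewrite ysizeXM (leq_trans (q_ysize _)).
rewrite addrC -scaleNr; apply: ysize_lin => //.
exact: leq_trans (ysizeC _) _.
Qed.

Lemma cm_F_powX p :
  cm_F g (bX ^+ p.+1) = cm_theta D' (cm_F g (bX ^+ p)) + cm_p g (cm_mu D (bX ^+ p)).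
Proof. by rewrite -(cm_theta_powX D) cm_F_theta. Qed.

(** The defect being of smaller y-degree than c b, the map cm_F raises the y-degree
    by that of c. *)
Lemma cm_F_raises_ysize b : (1 < ysize c)%N -> b != 0 -> (1 < ysize (cm_F g b))%N.
Proof.
set d := ysize c => d_gt1 bn0.
have d_gt0 : (0 < d)%N by exact: ltnW.
have pd := cm_p_ysize d_gt0 (leqnn d).
have defect_mono p s : (ysize (defect (bX ^+ p * bY ^+ s)%R) <= d.-1 + s)%N.
  elim: s => [|s IHs].
    rewrite expr0 mulr1 addn0; elim: p => [|p IHp].
      by rewrite /defect expr0 mulr1 subrr ysize0.
    have FXp : (ysize (cm_F g (bX ^+ p)%R) <= d)%N.
      have -> : cm_F g (bX ^+ p) = 1 *: defect (bX ^+ p) + c * bX ^+ p.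
        by rewrite scale1r subrK.
      apply: ysize_lin; first exact: leq_trans IHp (leq_pred _).
      by rewrite mulrC; elim: (p) => [|p' IH]; rewrite ?mul1r // exprS -mulrA ysizeXM.
    have -> : defect (bX ^+ p.+1) =
      1 *: (1 *: (cm_theta D' (cm_F g (bX ^+ p)) - bX * cm_F g (bX ^+ p)) +
        bX * defect (bX ^+ p)) + cm_p g (cm_mu D (bX ^+ p)).
      by rewrite /defect cm_F_powX !scale1r exprS; ring.
    apply: ysize_lin => //; apply: ysize_lin; last by rewrite ysizeXM.
    exact: ysize_theta_defect.
  have -> : defect (bX ^+ p * bY ^+ s.+1) =
    1 *: (bY * defect (bX ^+ p * bY ^+ s)) + cm_q g (cm_mu D (bX ^+ p * bY ^+ s)).
    by rewrite exprS mulrCA /defect cm_F_Y scale1r; ring.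
  apply: ysize_lin; first by rewrite addnS ysizeYM.
  by apply: leq_trans (q_ysize _) _; rewrite addnS.
have defect_b : (ysize (defect b) <= d.-1 + (ysize b).-1)%N.
  pose S b' := (ysize (defect b') <= d.-1 + (ysize b).-1)%N.
  apply: (ysize_ind (S := S) _ _ _ (leqnn (ysize b))).
  - by rewrite /S /defect linear0 mulr0 subrr ysize0.
  - by move=> a b1 b2 ? ?; rewrite /S defect_lin; apply: ysize_lin.
  - move=> p s lt_s; apply: leq_trans (defect_mono p s) _.
    by rewrite leq_add2l -ltnS (ltn_predK lt_s).
rewrite ltnNge; apply/negP => Fb.
have cn0 : c != 0 by rewrite -ysize_eq0 -lt0n.
have b_gt0 : (0 < ysize b)%N by rewrite lt0n ysize_eq0.
have : (ysize (c * b)%R <= d.-1 + (ysize b).-1)%N.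
  have -> : c * b = (-1) *: defect b + cm_F g b by rewrite scaleN1r /defect opprB subrK.
  apply: ysize_lin => //; apply: leq_trans Fb _.
  by rewrite addn_gt0 -ltnS prednK // d_gt1.
rewrite ysizeM // -/d; case: (d) d_gt0 => // d' _; case: (ysize b) b_gt0 => // n _.
by rewrite /= addnS ltnn.
Qed.

Context (c_ysize : (ysize c <= 1)%N).

(** Once c does not involve y, the estimate cm_p_ysize leaves no room for cm_p, and
    cm_p_rec becomes an equation for cm_q alone. *)
Lemma cm_p_eq0 v : cm_p g v = 0.
Proof. by apply/eqP; rewrite -ysize_eq0 -leqn0; apply: (@cm_p_ysize 1%N). Qed.

Lemma cm_q_rec v :
  bX * cm_q g v - cm_q g (cm_X D v) = cm_j D v *: c - cm_j D' (cm_f g v) *: 1.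
Proof.
apply/eqP; rewrite -subr_eq0; apply/eqP.
by have := cm_p_rec v; rewrite !cm_p_eq0 mulr0 subrr opprB => ->.
Qed.

Lemma cm_q_xsize n : (0 < n)%N -> (xsize c <= n)%N ->
  forall v, (xsize (cm_q g v) <= n.-1)%N.
Proof.
move=> n_gt0 cn; apply: (size_descent (@xsize_lin k) (@xsizeXM k) (t := cm_X D)).
  exact: finite_dim_bounded (@xsize_lin k) (cm_finite D).
move=> v; rewrite cm_q_rec -scaleNr; apply: xsize_lin => //.
exact: leq_trans (xsizeC _) _.
Qed.

Lemma cm_F_powXE p : cm_F g (bX ^+ p) = c * bX ^+ p.
Proof.
elim: p => [|p IHp]; first by rewrite expr0 mulr1.
rewrite cm_F_powX IHp cm_p_eq0 addr0 cm_theta_X ?exprS; first by ring.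
by rewrite mulrC; elim: (p) => [|p' IH]; rewrite ?mul1r // exprS -mulrA ysizeXM.
Qed.

(** The analogue in x: the defect has x-degree less than that of c on the whole of
    k[x,y]. *)
Lemma cm_F_raises_xsize b : (1 < xsize c)%N -> b != 0 -> (1 < xsize (cm_F g b))%N.
Proof.
set e := xsize c => e_gt1 bn0.
have e_gt0 : (0 < e)%N by exact: ltnW.
have qe := cm_q_xsize e_gt0 (leqnn e).
have defect_b : (xsize (defect b) <= e.-1)%N.
  apply: (ysize_ind (S := fun b' => (xsize (defect b') <= e.-1)%N) _ _ _
    (leqnn (ysize b))).
  - by rewrite /defect linear0 mulr0 subrr xsize0.
  - by move=> a b1 b2 ? ?; rewrite defect_lin; apply: xsize_lin.
  - move=> p s _; elim: s => [|s IHs].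
      by rewrite /defect expr0 mulr1 cm_F_powXE subrr xsize0.
    have -> : defect (bX ^+ p * bY ^+ s.+1) =
      1 *: (bY * defect (bX ^+ p * bY ^+ s)) + cm_q g (cm_mu D (bX ^+ p * bY ^+ s)).
      by rewrite exprS mulrCA /defect cm_F_Y scale1r; ring.
    by apply: xsize_lin; rewrite ?xsizeYM.
rewrite ltnNge; apply/negP => Fb.
have cn0 : c != 0 by rewrite -xsize_eq0 -lt0n.
have b_gt0 : (0 < xsize b)%N by rewrite lt0n xsize_eq0.
have : (xsize (c * b)%R <= e.-1)%N.
  have -> : c * b = (-1) *: defect b + cm_F g b by rewrite scaleN1r /defect opprB subrK.
  by apply: xsize_lin => //; apply: leq_trans Fb _; rewrite -ltnS prednK.
rewrite xsizeM // -/e; case: (e) e_gt0 => // e' _; case: (xsize b) b_gt0 => // n _.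
by rewrite addSn addnS /= ltnNge leq_addr.
Qed.

Lemma cm_F_scalar gamma : c = gamma *: 1 -> forall b, cm_F g b = gamma *: b.
Proof.
move=> Ec b.
have q0 v : cm_q g v = 0.
  apply/eqP; rewrite -xsize_eq0 -leqn0; apply: (@cm_q_xsize 1%N) => //.
  by rewrite Ec xsizeC.
apply: (ysize_ind (S := fun b' => cm_F g b' = gamma *: b') _ _ _ (leqnn (ysize b))).
- by rewrite linear0 scaler0.
- by move=> a b1 b2 F1 F2; rewrite !linearP F1 F2.
- move=> p s _; elim: s => [|s IHs].
    by rewrite expr0 mulr1 cm_F_powXE Ec -scalerAl mul1r.
  by rewrite exprS mulrCA cm_F_Y IHs q0 addr0 -scalerAr.
Qed.

End Normalized.

(** Surjectivity onto the kernel, on which homotopies have no effect, brings the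
    kernel elements of cm_mu_ker_x and cm_mu_ker_y into the image of the
    normalized morphism, against the two degree estimates unless c is a scalar. *)
Theorem cm_mor_rigid g :
  (forall w, cm_mu D' w = 0 -> exists2 b, cm_mu D b = 0 & cm_F g b = w) ->
  forall b, cm_j D' (cm_mu D' b) = cm_j D (cm_mu D b).
Proof.
have [g' [h [Fg' qg']]] := cm_normalize g => surj0.
have {surj0} surj w : cm_mu D' w = 0 -> exists b, cm_F g' b = w.
  by move=> /surj0[b mub Fb]; exists b; rewrite Fg' mub linear0 addr0.
have surjn0 w : w != 0 -> cm_mu D' w = 0 -> exists2 b, b != 0 & cm_F g' b = w.
  move=> wn0 /surj[b Fb]; exists b => //; apply: contraNneq wn0 => b0.
  by rewrite -Fb b0 linear0.
have cy : (ysize (cm_F g' 1%R) <= 1)%N.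
  rewrite leqNgt; apply/negP => c_gt1.
  have [w wn0 [wy /(surjn0 _ wn0)[b bn0 Fb]]] := cm_mu_ker_x D'.
  by have := cm_F_raises_ysize qg' c_gt1 bn0; rewrite Fb ltnNge wy.
have cx : (xsize (cm_F g' 1%R) <= 1)%N.
  rewrite leqNgt; apply/negP => c_gt1.
  have [w wn0 [wx /(surjn0 _ wn0)[b bn0 Fb]]] := cm_mu_ker_y D'.
  by have := cm_F_raises_xsize qg' cy c_gt1 bn0; rewrite Fb ltnNge wx.
have [gamma Ec] := size1_scalar cx cy.
have F'E := cm_F_scalar qg' cy Ec.
have gn0 : gamma != 0.
  have [w wn0 [_ /surj[b Fb]]] := cm_mu_ker_x D'.
  by apply: contraNneq wn0 => g0; rewrite -Fb F'E g0 scale0r.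
have jj v : cm_j D' (cm_f g' v) = gamma * cm_j D v.
  have q0 u : cm_q g' u = 0.
    by apply/eqP; rewrite -xsize_eq0 -leqn0; apply: (@cm_q_xsize g' qg' cy 1%N).
  have := cm_q_rec qg' cy v; rewrite !q0 mulr0 subrr Ec scalerA => /esym/eqP.
  rewrite -scalerBl scaler_eq0 oner_eq0 orbF subr_eq0 => /eqP <-.
  by rewrite mulrC.
move=> b; apply: (mulfI gn0); rewrite -jj -cm_F_mu F'E linearZ /=.
by rewrite linearZ.
Qed.

End Rigidity.

(** * Comparing the four relations *)

Section EnvelopeDatum.
Context (k : fieldType) (char0 : [pchar k] =i pred0).
Context (K : ainf_module (weyl k)) (E : envelope K).
Local Notation x := (weyl_x k).
Local Notation y := (weyl_y k).
Local Notation B := (bipoly k).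

Definition weyl_normal : B -> weyl k := normal_order x y.
HB.instance Definition _ := GRing.Linear.on weyl_normal.

Lemma weyl_normal_surj a : exists b, a = weyl_normal b.
Proof.
elim/weyl_normal_ind: a => [c _ _ [b ->] [b' ->]||_ [b ->]|_ [b ->]].
- by exists (c *: b + b'); rewrite linearP.
- by exists 1; rewrite /weyl_normal normal_order_1.
- by exists (bX k * b); rewrite /weyl_normal normal_order_X.
- by exists (bY k * b); rewrite /weyl_normal normal_order_Y.
Qed.

Lemma weyl_normal_inj : injective weyl_normal.
Proof. exact: normal_order_inj (weyl_relation k) char0. Qed.

(** The identification of k[x,y] with K^0 through normal ordering. *)
Definition env_chart (b : B) : deg0 K := m20 K (env_i E) (weyl_normal b).

Lemma env_chart_is_linear : linear env_chart.
Proof. by move=> c a b; rewrite /env_chart linearP linearPr. Qed.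
HB.instance Definition _ :=
  GRing.isLinear.Build k B (deg0 K) *:%R env_chart env_chart_is_linear.

Lemma env_chart1 : env_chart 1 = env_i E.
Proof. by rewrite /env_chart /weyl_normal normal_order_1 m20_unit. Qed.

Lemma env_chartY b : env_chart (bY k * b) = m20 K (env_chart b) y.
Proof. by rewrite /env_chart m20_y // /weyl_normal normal_order_Y. Qed.

Lemma env_chart_powX p : m20 K (env_chart (bX k ^+ p)) x = env_chart (bX k ^+ p.+1).
Proof.
have powX q : weyl_normal (bX k ^+ q) = x ^+ q.
  elim: q => [|q IHq]; first by rewrite !expr0 /weyl_normal normal_order_1.
  by rewrite !exprS /weyl_normal normal_order_X -/weyl_normal IHq.
by rewrite /env_chart !powX m20_powx.
Qed.

Lemma env_chart_inv : exists psi : {linear deg0 K -> B},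
  cancel env_chart psi /\ cancel psi env_chart.
Proof.
have surj u : exists b, env_chart b = u.
  have [a ->] := m20_surj E u; have [b ->] := weyl_normal_surj a.
  by exists b.
have inj : injective env_chart.
  by move=> a b /(bij_inj (env_bij E))/weyl_normal_inj.
pose g u := projT1 (cid (surj u)).
have gK : cancel g env_chart by move=> u; rewrite /g; case: cid.
have g_lin : linear g by move=> c u v; apply: inj; rewrite gK [RHS]linearP /= !gK.
exists (HB.pack_for {linear deg0 K -> B} g (GRing.isLinear.Build _ _ _ _ _ g_lin)).
split=> [b|u]; last exact: gK.
by apply: inj; exact: gK.
Qed.

Context (psi : {linear deg0 K -> B}).
Context (chartK : cancel env_chart psi) (psiK : cancel psi env_chart).

Definition env_theta : {linear B -> B} := psi \o (applyr (m20 K) x \o env_chart).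
Definition env_mu : {linear B -> deg1 K} := m1 K \o env_chart.

Lemma env_muX b : env_mu (env_theta b) = applyr (m21 K) x (env_mu b).
Proof. by rewrite /= psiK m1_m2. Qed.
Lemma env_muY b : env_mu (bY k * b) = applyr (m21 K) y (env_mu b).
Proof. by rewrite /= env_chartY m1_m2. Qed.
Lemma env_theta_powX p : env_theta (bX k ^+ p) = bX k ^+ p.+1.
Proof. by rewrite /= env_chart_powX chartK. Qed.
Lemma env_thetaY b : env_theta (bY k * b) =
  bY k * env_theta b - b + jbar E (env_mu b) *: 1.
Proof.
apply: (can_inj chartK); rewrite /= psiK env_chartY (m20_yx E).
by rewrite linearD linearB linearZ /= env_chartY psiK env_chart1.
Qed.
Lemma env_comm v :
  applyr (m21 K) y (applyr (m21 K) x v) - applyr (m21 K) x (applyr (m21 K) y v)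
  = v - jbar E v *: env_mu 1.
Proof. by rewrite /= (m21_yx E) env_chart1 !opprD opprK !addrA subrr add0r. Qed.

Definition env_datum : cm_datum k :=
  @CMDatum k (deg1 K) (applyr (m21 K) x) (applyr (m21 K) y) (jbar E) env_mu
    env_theta env_muX env_muY env_theta_powX env_thetaY env_comm (env_finite E).

End EnvelopeDatum.

(** The functional of K is b |-> j(m_1(b)) in the chart, so that this is the
    rigidity theorem for the datum of f. *)
Lemma lambda_of_surj_H0 (k : fieldType) (char0 : [pchar k] =i pred0)
  (K L : ainf_module (weyl k)) (E : envelope K) (F : envelope L)
  (f : ainf_mor K L) :
  (forall w, m1 L w = 0 -> exists2 u, m1 K u = 0 & f10 f u = w) ->
  lambda E =1 lambda F.
Proof.
move=> surj.
have [psi [chartK psiK]] := env_chart_inv char0 E.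
have [psi' [chartK' psiK']] := env_chart_inv char0 F.
pose D := env_datum chartK psiK; pose D' := env_datum chartK' psiK'.
pose F0 : {linear bipoly k -> bipoly k} := psi' \o (f10 f \o env_chart E).
pose p : {linear deg1 K -> bipoly k} := psi' \o applyr (f2 f) (weyl_x k).
pose q : {linear deg1 K -> bipoly k} := psi' \o applyr (f2 f) (weyl_y k).
have f10E u a : f10 f (m20 K u a) = m20 L (f10 f u) a + f2 f (m1 K u) a.
  by rewrite -f10_m20 addrC subrK.
have f2_1 v : f2 f v 1 = 0.
  have := f2_m2 f v 1 1; rewrite m20_unit !m3_unitl mul1r m21_unit subrr.
  by rewrite linear0 !addr0.
have Fmu b : cm_mu D' (F0 b) = f11 f (cm_mu D b) by rewrite /= psiK' f1_m1.
have Ftheta b : F0 (cm_theta D b) = cm_theta D' (F0 b) + p (cm_mu D b).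
  by rewrite /= psiK psiK' f10E linearD.
have FY b : F0 (bY k * b) = bY k * F0 b + q (cm_mu D b).
  rewrite /= env_chartY f10E linearD; congr (_ + _).
  by apply: (can_inj chartK'); rewrite psiK' env_chartY psiK'.
(* f_2(v, y x) = f_2(v, x y) since f_2(v, 1) = 0. *)
have pq v : bY k * p v + q (cm_X D v) = cm_theta D' (q v) + p (cm_Y D v)
    + cm_j D' (f11 f v) *: 1 - cm_j D v *: F0 1.
  apply: (can_inj chartK'); rewrite /= !linearB !linearD !linearZ /=.
  rewrite env_chartY !psiK' !env_chart1.
  have := f2_m2 f v (weyl_x k) (weyl_y k).
  have := f2_m2 f v (weyl_y k) (weyl_x k).
  rewrite (jbarP E) (jbarP F) (env_m3x E) (env_m3x F) linear0 !addr0 linearZ /=.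
  have -> : f2 f v (weyl_y k * weyl_x k) = f2 f v (weyl_x k * weyl_y k).
    by rewrite weyl_yx linearBr f2_1 subr0.
  move=> yx ->; rewrite subrK scalerN [X in _ = X - _]addrAC yx.
  by rewrite [X in _ = X - _]addrAC addrK subrK.
have rigid := @cm_mor_rigid k D D' (@CMMor k D D' F0 (f11 f) p q Fmu Ftheta FY pq).
move=> a; have [b ->] := weyl_normal_surj a.
rewrite /lambda /ibar -!m1_m2; apply/esym; apply: rigid => w w0.
have [u u0 fu] := surj _ w0; exists (psi u); first by rewrite /= psiK.
by apply: (can_inj chartK'); rewrite /= psiK psiK'.
Qed.

Section Equivalences.
Context (k : fieldType) (A : algType k).
Implicit Types K L : ainf_module A.

Lemma strictly_isomorphic_isomorphic K L :
  strictly_isomorphic K L -> isomorphic K L.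
Proof. by case=> f [_ finv]; exists f. Qed.

Lemma isomorphic_quasi_isomorphic K L : isomorphic K L -> quasi_isomorphic K L.
Proof.
case=> f [g [[gf0 gf1 _] [fg0 fg1 _]]]; exists f; split.
  by exists (H0_map g) => u; apply: val_inj; [apply: gf0|apply: fg0].
exists (H1_map g) => c; rewrite -[c]reprK; move: (repr c) => v.
  by rewrite [H1_map f _]H1_mapE H1_mapE; congr (\pi_(H1 K)%qT _); apply: gf1.
by rewrite [H1_map g _]H1_mapE H1_mapE; congr (\pi_(H1 L)%qT _); apply: fg1.
Qed.

End Equivalences.

(** The canonical strict morphisms in both directions are inverse to each other
    on i.a, hence on K^0, hence on K^1 = m_1(K^0). *)
Lemma strictly_isomorphic_of_lambda (k : fieldType) (char0 : [pchar k] =i pred0)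
  (K L : ainf_module (weyl k)) (E : envelope K) (F : envelope L) :
  lambda E =1 lambda F -> strictly_isomorphic K L.
Proof.
move=> EF; have FE : lambda F =1 lambda E by move=> a; rewrite EF.
have [f [f_strict fE]] := strict_morphism_of_lambda char0 EF.
have [g [g_strict gE]] := strict_morphism_of_lambda char0 FE.
have gf0 u : f10 g (f10 f u) = u by have [a ->] := m20_surj E u; rewrite fE gE.
have fg0 u : f10 f (f10 g u) = u by have [a ->] := m20_surj F u; rewrite gE fE.
exists f; split=> //; exists g; split; split=> [u|v|v a] /=.
- exact: gf0.
- by have [u ->] := m1_surj E char0 v; rewrite -!f1_m1 gf0.
- by rewrite /comp_f2 f_strict g_strict linear0 addr0.
- exact: fg0.
- by have [u ->] := m1_surj F char0 v; rewrite -!f1_m1 fg0.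
- by rewrite /comp_f2 f_strict g_strict linear0 addr0.
Qed.

Theorem theorem3 (k : closedFieldType) (char0 : [pchar k] =i pred0)
    (K K' : ainf_module (weyl k)) (E : envelope K) (E' : envelope K') :
  [<-> strictly_isomorphic K K';
       isomorphic K K';
       quasi_isomorphic K K';
       lambda E =1 lambda E'].
Proof.
tfae.
- exact: strictly_isomorphic_isomorphic.
- exact: isomorphic_quasi_isomorphic.
- case=> f [[g _ gK] _]; apply: (@lambda_of_surj_H0 k char0 K K' E E' f) => w w0.
  have wH : w \in cocycle0 K' by apply/eqP.
  exists (val (g (Sub w wH))); first exact/eqP/(valP (g (Sub w wH))).
  by have := congr1 val (gK (Sub w wH)).
- exact: strictly_isomorphic_of_lambda.
Qed.
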